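(* Let $p$ be a prime with $p\equiv 3 \pmod 4$. Then the adjacency matrices $A(p^2)$ of the Paley graph $P(p^2)$ and $A^*(p^2)$ of the Peisert graph $P^*(p^2)$ on $p^2$ vertices are conjugate in $\mathrm{GL}_{p^2}(\mathbb{Z})$, i.e. there is $T\in \mathrm{GL}_{p^2}(\mathbb{Z})$ with $T A(p^2) T^{-1} = A^*(p^2)$.
   Context: Let $q = p^2$, let $\mathbb{F}_q$ be the field with $q$ elements, choose a primitive element $\beta$ of $\mathbb{F}_q$ (a generator of the multiplicative group $\mathbb{F}_q^{\times}$), and let $U := \langle \beta^4\rangle \leq \mathbb{F}_q^{\times}$ be the subgroup of fourth powers, so that $\mathbb{F}_q^{\times} = U\cup \beta U\cup\beta^2U\cup\beta^3U$. Both graphs have vertex set $\mathbb{F}_q$. Two vertices $i,j\in\mathbb{F}_q$ are joined in the Paley graph $P(q)$ if and only if $i-j\in U\cup\beta^2U = (\mathbb{F}_q^{\times})^2$, and they are joined in the Peisert graph $P^*(q)$ if and only if $i-j\in U\cup\beta U$. $A(q)$ and $A^*(q)$ denote the ($0/1$) adjacency matrices of $P(q)$ and $P^*(q)$, respectively, with rows and columns indexed by $\mathbb{F}_q$. $\mathrm{GL}_n(\mathbb{Z})$ is the group of integral $n\times n$ matrices with determinant $\pm1$. *)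

(* Defs.v *)
From mathcomp Require Import all_boot all_order all_algebra all_fingroup all_solvable all_field.

Set Implicit Arguments.
Unset Strict Implicit.
Unset Printing Implicit Defensive.

Import GRing.Theory.
Local Open Scope ring_scope.

Section PaleyPeisert.

Variables (F : finFieldType) (beta : {unit F}).

Definition primitive_element : bool := generator [set: {unit F}] beta.

Definition fourth_powers : {group {unit F}} := <[beta ^+ 4]>%G.

Definition paley_rel : rel F := fun i j =>
  i - j \in [set val u | u in fourth_powers :|: (beta ^+ 2) *: fourth_powers]%g.

Definition peisert_rel : rel F := fun i j =>
  i - j \in [set val u | u in fourth_powers :|: beta *: fourth_powers]%g.

End PaleyPeisert.

(* Rows and columns are indexed by V itself, through the enumeration of V. *)
Definition adjacency_mx (V : finType) (e : rel V) : 'M[int]_#|V| :=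
  \matrix_(i, j) (e (enum_val i) (enum_val j))%:R.

(* Main.v *)
(* Write q = p^2, e = (p+1)/2 and p + 1 = 4h.  Since U contains F_p^*, each of the two connection
   sets is a union of e punctured lines through 0 in the affine plane F over F_p.  Hence for either
   graph N := A + e I is the sum of the incidence matrices of e parallel classes, so that
   N^2 = p N + e (e - 1) J and N J = J N = p e J.

   Integral classification.  On the sum-zero lattice Y one has N^2 = p N, and Smith's normal form
   shows that N|Y is conjugate to [[p, 0], [C, 0]], where only C modulo p matters; if c := rank_p C
   is smaller than the size of C, the scaling freedom in a zero row makes C the partial identity of
   rank c.  The full lattice Z^q is recovered by gluing Y with Z.1, and the glue is a vector y of
   Y / qY with y N = p e y; when c >= 2 the centralizer of N|Y moves y to a standard vector.  So N
   is determined up to GL_q(Z)-conjugacy by p and c.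

   The p-rank.  Modulo p, 2N is 1 + z^((q-1)/2) (Paley), respectively
   1 + c1 z^((q-1)/4) + c3 z^(3(q-1)/4) (Peisert), evaluated at z = x - y.  Expanding in the monomials
   x^(i + p j), 0 <= i, j < p, with Frobenius turns N into a sparse matrix whose nonzero entries
   sit on boxes of exponents; in both cases c = 4 h^2 - 1. *)

Require Import Defs.
From mathcomp Require Import all_boot all_order all_algebra all_fingroup all_solvable all_field.
From mathcomp Require Import zify ring.

Set Implicit Arguments.
Unset Strict Implicit.
Unset Printing Implicit Defensive.

Import GRing.Theory.
Local Open Scope ring_scope.

(** * Integral normal forms *)

Lemma unitmx_transvection (R : comUnitRingType) n (i j : 'I_n) (a : R) :
  i != j -> 1%:M + a *: delta_mx i j \in unitmx.
Proof.
move=> ij; suff /mulmx1_unit[]: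
  (1%:M + a *: delta_mx i j) *m (1%:M - a *: delta_mx i j) = 1%:M by [].
rewrite mulmxDl mul1mx mulmxBr mulmx1 -scalemxAl -scalemxAr mul_delta_mx_0 1?eq_sym //.
by rewrite !scaler0 subr0 subrK.
Qed.

(** Modulo $m$ the three factors of [W] act by $x e_i \mapsto x e_i + e_j \mapsto e_i + e_j \mapsto
    e_i$. The index $j$ is the price: nothing is claimed about the image of $e_j$. *)
Lemma unimodular_normalize_entry n (i j : 'I_n) (a x m k : int) :
    i != j -> x * a = 1 + m * k ->
  exists2 W : 'M[int]_n, W \in unitmx &
    (exists z : 'rV_n, x *: delta_mx 0 i *m W = delta_mx 0 i + m *: z)
    /\ (forall l, l != i -> l != j -> delta_mx 0 l *m W = delta_mx 0 l :> 'rV_n).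
Proof.
move=> ij xa; have ji : j != i by rewrite eq_sym.
exists ((1%:M + a *: delta_mx i j) *m (1%:M + (1 - x) *: delta_mx j i)
  *m (1%:M + (-1) *: delta_mx i j)).
  by rewrite !unitmx_mul !unitmx_transvection.
have E := (mulmxDr, mulmxDl, mulmx1, =^~ scalemxAr, =^~ scalemxAl, mul_delta_mx_cond).
split; last first.
  move=> l /negPf li /negPf lj; rewrite !mulmxA.
  by rewrite !(E, li, lj, mulr0n, mul0mx, scaler0, addr0).
exists ((k * (1 - x)) *: delta_mx 0 i + (k * x) *: delta_mx 0 j).
rewrite !mulmxA !(E, negPf ij, negPf ji, eqxx, mulr0n, mulr1n, mul0mx, scaler0, addr0, add0r).
apply/rowP=> l; rewrite !mxE.
set u := (_ && _)%:R; set v := (_ && _)%:R.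
have -> : m * (k * (1 - x) * u + k * x * v) = (m * k) * ((1 - x) * u + x * v) by ring.
have -> : m * k = x * a - 1 by rewrite xa addrAC subrr add0r.
ring.
Qed.

Lemma sorted_dvdz_nth (d : seq int) i j : sorted dvdz d -> (i <= j)%N -> (d`_i %| d`_j)%Z.
Proof.
move=> sd ij; have [jd | dj] := ltnP j (size d); last by rewrite (nth_default _ dj) dvdz0.
have tr : transitive dvdz by move=> y x z; apply: dvdz_trans.
have rf : reflexive dvdz by move=> x; apply: dvdzz.
exact: (sorted_leq_nth tr rf 0 sd _ _ (leq_ltn_trans ij jd) jd ij).
Qed.

Lemma mxtrace_conj (R : comUnitRingType) n (A B T : 'M[R]_n) :
  T \in unitmx -> T *m A = B *m T -> \tr B = \tr A.
Proof. by move=> uT TA; rewrite -(mulmxK uT B) -TA -mulmxA mxtrace_mulC mulmxKV. Qed.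

(** With $N = LDR$ in Smith form, conjugation by $R$ gives $G = RLD$. Its columns vanish where those
    of $D$ do, and $N^2 = pN$ becomes $DG = pD$, whose row $i$ can be divided by $d_i$ when $d_i
    \neq 0$. *)
Lemma quasi_idempotent_triangular m (p : int) (N : 'M[int]_m) :
    p != 0 -> N *m N = p *: N ->
  exists e, exists G T, [/\ (e <= m)%N, T \in unitmx, T *m N = G *m T,
    forall i j : 'I_m, (i < e)%N -> G i j = p *+ (i == j)
  & forall i j : 'I_m, (e <= j)%N -> G i j = 0].
Proof.
move=> p0 NN; have [L uL [R uR [d sd defN]]] := int_Smith_normal_form N.
set D := \matrix_(i, j) _ in defN.
(* Entries of [d] beyond its size read as 0. By the divisibility chain everything after the first
   zero is zero, so [e] counts the nonzero diagonal entries of $D$. *)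
pose s := mkseq (fun i => d`_i) m; pose e := find (pred1 0) s.
have sz_s : size s = m by rewrite size_mkseq.
have le_em : (e <= m)%N by rewrite -sz_s find_size.
have d_neq0 i : (i < e)%N -> d`_i != 0.
  move=> ie; have := before_find 0 ie; rewrite nth_mkseq ?(leq_trans ie) //=.
  by move=> ->.
have d_eq0 j : (j < m)%N -> (e <= j)%N -> d`_j = 0.
  move=> jm ej; have em := leq_ltn_trans ej jm.
  have : d`_e = 0.
    have := @nth_find _ 0 (pred1 0) s; rewrite has_find sz_s em => /(_ isT) /=.
    by rewrite nth_mkseq // => /eqP.
  by move=> de; have := sorted_dvdz_nth sd ej; rewrite de dvd0z => /eqP.
exists e, (R *m L *m D), R; split=> //.
- by rewrite defN !mulmxA.
- have : D *m (R *m L *m D) = p *: D.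
    have uRL : R *m L \in unitmx by rewrite unitmx_mul uR.
    apply: (can_inj (mulKmx uL)); apply: (can_inj (mulmxK uR)).
    by rewrite -scalemxAr -scalemxAl -defN -NN {1}defN !mulmxA defN !mulmxA.
  move=> /matrixP DG i j ie; have := DG i j;
  rewrite 2!mxE (bigD1 i) //= big1 => [|k ki]; last first.
    by move: ki; rewrite mxE -val_eqE eq_sym => /negPf ->; rewrite mul0r.
  by rewrite addr0 mxE eqxx mulr1n [D i j]mxE [p * _]mulrC mulrnAl -mulrnAr
    => /(mulfI (d_neq0 _ ie)) ->.
- move=> i j ej; rewrite mxE big1 // => k _; rewrite [D k j]mxE.
  by case: eqP => [->|_]; rewrite ?(d_eq0 _ (ltn_ord j) ej) ?mul0rn ?mulr0n mulr0.
Qed.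

(** The triangular form has trace $pe$, so the trace hypothesis forces $e = d$. *)
Lemma quasi_idempotent_block d (p : int) (N : 'M[int]_(d + d)) :
    p != 0 -> N *m N = p *: N -> \tr N = p *+ d ->
  exists C, exists2 T, T \in unitmx & T *m N = block_mx p%:M 0 C 0 *m T.
Proof.
move=> p0 NN trN; have [e [G [T [le_e uT TN Gl Gr]]]] := quasi_idempotent_triangular p0 NN.
have ed : e = d.
  have := mxtrace_conj uT TN; rewrite trN /mxtrace.
  rewrite (bigID (fun i : 'I__ => (i < e)%N)) /= [X in _ + X]big1 => [|i]; last first.
    by rewrite -leqNgt => ei; rewrite Gr.
  rewrite addr0 (eq_bigr (fun=> p)) => [|i ie]; last by rewrite Gl // eqxx.
  rewrite (big_ord_narrow le_e) sumr_const card_ord -[LHS]mulr_natr -[RHS]mulr_natr.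
  move/(mulfI p0)/eqP.
  by rewrite Num.Theory.eqr_nat => /eqP.
exists (dlsubmx G), T => //; rewrite TN; congr (_ *m _).
rewrite -[LHS]submxK; congr block_mx; apply/matrixP=> i j; rewrite !mxE.
- by rewrite Gl ?ed //= (inj_eq (@lshift_inj _ _)).
- by rewrite Gr //= ed leq_addr.
- by rewrite Gr //= ed leq_addr.
Qed.

Lemma map_mx_unitmx (R S : comUnitRingType) (f : {rmorphism R -> S}) n (A : 'M[R]_n) :
  A \in unitmx -> map_mx f A \in unitmx.
Proof. by rewrite !unitmxE det_map_mx; apply: rmorph_unit. Qed.

(** * Unimodular normal forms modulo p *)

Section CharP.

Variables (F : fieldType) (p : nat) (charFp : p \in [pchar F]).

Lemma intr_pchar_eq0 (x : int) : (x%:~R == 0 :> F) = (p%:Z %| x)%Z.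
Proof. by rewrite (dvdz_pcharf charFp). Qed.

Lemma map_intr_mx_eq m n (A B : 'M[int]_(m, n)) :
    map_mx intr A = map_mx intr B :> 'M[F]_(m, n) ->
  exists X, A = B + p%:Z *: X.
Proof.
move=> /matrixP AB; exists (\matrix_(i, j) ((A i j - B i j) %/ p%:Z)%Z).
apply/matrixP=> i j; rewrite !mxE [p%:Z * _]mulrC divzK; first by rewrite addrC subrK.
by rewrite -intr_pchar_eq0 rmorphB /= subr_eq0; have := AB i j; rewrite !mxE => ->.
Qed.

Lemma map_intr_mx_modp m n (A : 'M[int]_(m, n)) :
  map_mx intr (p%:Z *: A) = 0 :> 'M[F]_(m, n).
Proof.
by apply/matrixP=> i j; rewrite !mxE; apply/eqP; rewrite intr_pchar_eq0 dvdz_mulr.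
Qed.

Lemma intr_mod_inverse (x : int) r :
  x%:~R != 0 :> F -> exists a k, x * a = 1 + p%:Z ^+ r * k.
Proof.
rewrite intr_pchar_eq0 => npx.
have : coprimez (p%:Z ^+ r) x.
  by rewrite coprimezXl // coprimezE prime_coprime ?(pcharf_prime charFp).
case/coprimezP=> [[u v]] /= uv; exists v, (- u).
by rewrite mulrN -uv mulrC [p%:Z ^+ r * u]mulrC addrAC subrr add0r.
Qed.

Lemma mxrank_map_unimodular m n (A : 'M[int]_(m, n)) L R :
    L \in unitmx -> R \in unitmx ->
  \rank (map_mx intr (L *m A *m R) : 'M[F]_(m, n)) = \rank (map_mx intr A : 'M[F]_(m, n)).
Proof.
move=> uL uR; rewrite !map_mxM mxrankMfree ?row_free_unit ?map_mx_unitmx //.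
by rewrite (eqmxMfull _ _) // row_full_unit map_mx_unitmx.
Qed.

(** The Smith form has $c$ leading diagonal entries prime to $p$ and the others divisible by $p$. As
    $g > 0$, some row vanishes modulo $p$; its index is the spare one when the leading entries are
    scaled to 1. *)
Lemma unimodular_rank_normal_form c g (C : 'M[int]_(c + g)) :
    (0 < g)%N -> \rank (map_mx intr C : 'M[F]_(c + g)) = c ->
  exists P Q X, [/\ P \in unitmx, Q \in unitmx
    & P *m C *m Q = block_mx 1%:M 0 0 0 + p%:Z *: X].
Proof.
move=> g0 rkC; have [L uL [R uR [d sd defC]]] := int_Smith_normal_form C.
set D := \matrix_(i, j) _ in defC.
have defD : invmx L *m C *m invmx R = D by rewrite defC !mulmxA mulmxK // mulVmx // mul1mx.
have rkD : \rank (map_mx intr D : 'M[F]_(c + g)) = c.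
  by rewrite -defD mxrank_map_unimodular ?unitmx_inv.
pose n := (c + g)%N; pose s := mkseq (fun i => d`_i) n.
pose isz x := x%:~R == 0 :> F; pose e := find isz s.
have sz_s : size s = n by rewrite size_mkseq.
have le_en : (e <= n)%N by rewrite -sz_s find_size.
have d_neq0 i : (i < e)%N -> (d`_i)%:~R != 0 :> F.
  move=> ie; have := before_find 0 ie; rewrite nth_mkseq ?(leq_trans ie) //=.
  by rewrite /isz => ->.
have d_eq0 j : (j < n)%N -> (e <= j)%N -> (d`_j)%:~R = 0 :> F.
  move=> jn ej; have en := leq_ltn_trans ej jn.
  have : isz (d`_e).
    have := @nth_find _ 0 isz s; rewrite has_find sz_s en => /(_ isT) /=.
    by rewrite nth_mkseq.
  rewrite /isz intr_pchar_eq0 => de; apply/eqP; rewrite intr_pchar_eq0.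
  exact: dvdz_trans de (sorted_dvdz_nth sd ej).
(* If all diagonal entries were nonzero modulo $p$, the rank would be $c + g > c$. *)
have lten : (e < n)%N.
  rewrite ltnNge; apply/negP=> ne.
  have : \det (map_mx intr D : 'M[F]_(c + g)) != 0.
    have -> : D = diag_mx (\row_i d`_i).
      by apply/matrixP=> i j; rewrite !mxE.
    rewrite map_diag_mx det_diag prodf_seq_neq0; apply/allP=> i _ /=.
    by rewrite !mxE d_neq0 // (leq_trans _ ne).
  rewrite -unitfE -unitmxE => /mxrank_unit; rewrite rkD => /eqP.
  by rewrite -[X in X == _]addn0 eqn_add2l eq_sym -leqn0 leqNgt g0.
have [W uW DW] : exists2 W, W \in unitmx & map_mx intr (D *m W) = pid_mx e :> 'M[F]_(c + g).
  (* The entries are scaled one at a time. Each step may move the basis vector of index [e], but row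
     [e] is zero modulo $p$ and does not notice. *)
  have : forall k, (k <= e)%N -> exists2 W, W \in unitmx &
    map_mx intr (D *m W) = \matrix_(i, j) ((if (i < k)%N then 1 else (d`_i)%:~R) *+ (i == j))
      :> 'M[F]_(c + g).
    elim=> [_|k IHk ke].
      exists 1%:M; rewrite ?unitmx1 // mulmx1; apply/matrixP=> i j.
      by rewrite !mxE rmorphMn.
    have [W uW DW] := IHk (ltnW ke).
    have rowE (f : 'I_(c + g) -> F) l :
        row l (\matrix_(i, j) (f i *+ (i == j))) = f l *: delta_mx 0 l :> 'rV_(c + g).
      by apply/rowP=> j; rewrite !mxE /= mulr_natr eq_sym.
    pose i0 : 'I_(c + g) := Ordinal (leq_trans ke le_en).
    pose j0 : 'I_(c + g) := Ordinal lten.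
    have [a [b]] := intr_mod_inverse 1 (d_neq0 _ ke); rewrite expr1 => dab.
    have ij : i0 != j0 by rewrite -val_eqE /= neq_ltn ke.
    have [W' uW' [[z Wi] Wl]] := unimodular_normalize_entry ij dab.
    exists (W *m W'); first by rewrite unitmx_mul uW.
    rewrite mulmxA map_mxM DW; apply/row_matrixP=> l; rewrite row_mul !rowE.
    have [->|nli] := eqVneq l i0.
      rewrite ltnn leqnn scale1r; have := congr1 (map_mx intr : _ -> 'rV[F]_(c + g)) Wi.
      by rewrite map_mxD map_intr_mx_modp addr0 map_mxM map_mxZ !map_delta_mx.
    have [->|nlj] := eqVneq l j0.
      by rewrite ltnNge (ltnW ke) /= ltnNge ke /= d_eq0 // !scale0r mul0mx.
    have -> : (l < k.+1)%N = (l < k)%N.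
      by rewrite ltnS leq_eqVlt (_ : (l == k :> nat) = false) //; apply: negPf.
    rewrite -scalemxAl; congr (_ *: _).
    by have := congr1 (map_mx intr : _ -> 'rV[F]_(c + g)) (Wl l nli nlj);
      rewrite map_mxM !map_delta_mx.
  move=> /(_ e (leqnn e)) [W uW DW]; exists W; rewrite // DW.
  apply/matrixP=> i j; rewrite !mxE.
  have [ie|ei] := ltnP i e; first by rewrite andbT.
  by rewrite andbF d_eq0 // mul0rn.
have ec : e = c.
  rewrite -rkD -(mxrank_map_unimodular _ (unitmx1 _ _) uW) mul1mx DW.
  by rewrite rank_pid_mx.
have [X defX] : exists X, D *m W = pid_mx c + p%:Z *: X.
  by apply: map_intr_mx_eq; rewrite DW map_pid_mx ec.
exists (invmx L), (invmx R *m W), X; split; rewrite ?unitmx_mul ?unitmx_inv ?uR //.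
by rewrite mulmxA defD defX pid_mx_block.
Qed.

(** The Smith form of a single row, followed by a transposition, is $x e_i$; here $x$ is prime to
    $p$, hence invertible modulo $p^r$, and $j$ is the spare index for scaling $x$ to 1. *)
Lemma unimodular_vector_normal_form n (i j : 'I_n) r (u : 'rV[int]_n) :
    i != j -> map_mx intr u != 0 :> 'rV[F]_n ->
  exists2 W, W \in unitmx & exists z, u *m W = delta_mx 0 i + p%:Z ^+ r *: z.
Proof.
move=> ij nzu; have [L uL [R uR [d sd defu]]] := int_Smith_normal_form u.
have [S uS [x defS]] : exists2 S, S \in unitmx & exists x, u *m S = x *: delta_mx 0 i.
  pose i0 : 'I_n := Ordinal (leq_ltn_trans (leq0n i) (ltn_ord i)).
  exists (invmx R *m perm_mx (tperm i0 i)).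
    by rewrite unitmx_mul unitmx_inv uR unitmx_perm.
  exists (L 0 0 * d`_0); rewrite mulmxA defu mulmxK //.
  have -> : L *m (\matrix_(k, l) (d`_k *+ (k == l :> nat))) = (L 0 0 * d`_0) *: delta_mx 0 i0.
    apply/rowP=> l; rewrite !mxE big_ord1 mxE /= -[in LHS]mulr_natr mulrA.
    by congr (_ * _%:R); rewrite -val_eqE eq_sym.
  by rewrite -scalemxAl -rowE; congr (_ *: _);
    apply/rowP=> l; rewrite !mxE /= tpermL eq_sym.
have nzx : x%:~R != 0 :> F.
  apply: contraNneq nzu => x0; rewrite -[u](mulmxK uS) defS -scalemxAl map_mxZ /= x0.
  by rewrite scale0r.
have [a [k xa]] := intr_mod_inverse r nzx.
have [W uW [[z Wi] _]] := unimodular_normalize_entry ij xa.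
exists (S *m W); first by rewrite unitmx_mul uS.
by exists z; rewrite mulmxA defS.
Qed.

End CharP.

(** * Normal form on the sum-zero lattice, with its glue vector *)

Definition quasi_idempotent_nf c g (p : int) : 'M[int]_((c.+2 + g) + (c.+2 + g)) :=
  block_mx p%:M 0 (block_mx 1%:M 0 0 0) 0.

(** Once the first block is $e_0$, the third is forced modulo $p^2$ by the eigenvector congruence.
    The rank is written [c.+2] so that $e_0$ has a spare companion $e_1$. *)
Definition eigenvector_nf c g (p e : int) : 'rV[int]_((c.+2 + g) + (c.+2 + g)) :=
  row_mx (row_mx (delta_mx 0 0) 0) (row_mx ((p * (e - 1)) *: delta_mx 0 0) 0).

(** Write $y = (a_1, a_2 \mid b_1, b_2)$. As $2e = p + 1$, both $e$ and $e - 1$ are invertible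
    modulo $p$, so the congruence makes $a_2, b_1, b_2$ divisible by $p$ and gives $b_1 = p(e-1)a_1$
    modulo $p^2$. Hence $a_1$ is nonzero modulo $p$, and one $W$ normalizes both $a_1$ and $b_1$. *)
Lemma eigenvector_normal_form (F : fieldType) (p : nat) (e : int) c g
    (y z : 'rV[int]_((c.+2 + g) + (c.+2 + g))) :
    p \in [pchar F] -> p%:Z + 1 = e * 2 ->
    y *m quasi_idempotent_nf c g p = (p%:Z * e) *: y + p%:Z ^+ 2 *: z ->
    map_mx intr y != 0 :> 'rV[F]_((c.+2 + g) + (c.+2 + g)) ->
  exists2 Q, Q \in unitmx & Q *m quasi_idempotent_nf c g p = quasi_idempotent_nf c g p *m Q
    /\ exists z', y *m Q = eigenvector_nf c g p e + p%:Z ^+ 2 *: z'.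
Proof.
move=> charFp pe.
have p0 : p%:Z != 0 by have := prime_gt0 (pcharf_prime charFp); lia.
rewrite -(hsubmxK y) -(hsubmxK (lsubmx y)) -(hsubmxK (rsubmx y)).
rewrite -(hsubmxK z) -(hsubmxK (lsubmx z)) -(hsubmxK (rsubmx z)).
move: (lsubmx (lsubmx y)) (rsubmx (lsubmx y)) (lsubmx (rsubmx y)) (rsubmx (rsubmx y)).
move: (lsubmx (lsubmx z)) (rsubmx (lsubmx z)) (lsubmx (rsubmx z)) (rsubmx (rsubmx z)).
move=> z1 z2 z3 z4 a1 a2 b1 b2 {y z}.
rewrite /quasi_idempotent_nf scalar_mx_block.
rewrite ?(mul_row_block, mulmx0, addr0, add0r, mulmx1) !mul_mx_scalar.
rewrite !scale_row_mx !add_row_mx addr0.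
have pE : p%:Z = e * 2 - 1 by rewrite -pe addrK.
(* Doubling the equation replaces $2e$ by $p + 1$; this inverts $1 - e$ modulo $p$, and $e$ in
   [mod_p0], with explicit quotients. *)
have mod_p (x w : int) : p%:Z * x = p%:Z * e * x + p%:Z ^+ 2 * w -> x = p%:Z * (x + w * 2).
  move=> H; apply: (mulfI p0); transitivity (p%:Z * x * 2 - p%:Z * x); first by ring.
  have -> : p%:Z * x * 2 = (p%:Z + 1) * (p%:Z * x) + p%:Z ^+ 2 * w * 2 by rewrite pe {1}H; ring.
  by ring.
have mod_p0 (x w : int) : 0 = p%:Z * e * x + p%:Z ^+ 2 * w -> x = p%:Z * - (x + w * 2).
  move=> H; apply: (mulfI p0); transitivity (p%:Z * x * (e * 2) - p%:Z ^+ 2 * x).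
    by rewrite -pe; ring.
  transitivity ((p%:Z * e * x + p%:Z ^+ 2 * w) * 2 - p%:Z ^+ 2 * (w * 2 + x)); first by ring.
  by rewrite -H; ring.
case/eq_row_mx=> /eq_row_mx[Ea1 Ea2]; rewrite -row_mx0 => /eq_row_mx[Eb1 Eb2].
have [t Dt] : exists t, a2 = p%:Z *: t.
  exists (a2 + 2 *: z2); apply/rowP=> i; move/rowP/(_ i): Ea2.
  by rewrite !mxE [2 * _]mulrC; apply: mod_p.
have [t' Dt'] : exists t', b2 = p%:Z *: t'.
  exists (- (b2 + 2 *: z4)); apply/rowP=> i; move/rowP/(_ i): Eb2.
  by rewrite !mxE [2 * _]mulrC; apply: mod_p0.
have [s Ds] : exists s, b1 = p%:Z *: s.
  exists (- (b1 + 2 *: z3)); apply/rowP=> i; move/rowP/(_ i): Eb1.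
  by rewrite !mxE [2 * _]mulrC; apply: mod_p0.
have Db1 : b1 = (p%:Z * (e - 1)) *: a1 + p%:Z ^+ 2 *: z1.
  by apply: (addrI (p%:Z *: a1)); rewrite Ea1 addrA -scalerDl; congr (_ *: _ + _); ring.
move=> nzy; have nza1 : map_mx intr a1 != 0 :> 'rV[F]_c.+2.
  apply: contraNneq nzy => a10; rewrite !map_row_mx /= a10 Dt Dt' Ds.
  by rewrite !(map_intr_mx_modp charFp) !row_mx0.
have [W uW [v Wv]] := @unimodular_vector_normal_form _ _ charFp _ 0 1 2 a1 isT nza1.
pose d : 'cV[int]_c.+2 := delta_mx 0 0.
have dd : (delta_mx 0 0 : 'rV_c.+2) *m d = 1%:M.
  by rewrite mul_delta_mx; apply/matrixP=> i j; rewrite !mxE !ord1.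
pose D (x : 'rV[int]_g) := W *m d *m x.
(* W normalizes the unit coordinates a1; the off-diagonal blocks then use the unit coordinate to
   clear a2 and b2, which are divisible by p.  The dl block is forced by commutation. *)
pose Q : 'M[int]_((c.+2 + g) + (c.+2 + g)) :=
  block_mx (block_mx W (D (- (2 * p%:Z) *: t)) 0 1%:M) 0
           (block_mx 0 (D (- 2 *: t)) 0 0) (block_mx W (D (2 *: t')) 0 1%:M).
exists Q.
  rewrite unitmxE det_lblock !det_ublock !det1 !mulr1 unitrM -unitmxE.
  by rewrite uW.
split.
  rewrite /Q !(mulmx_block, mulmx0, mul0mx, mulmx1, mul1mx, addr0, add0r, add_block_mx).
  rewrite !mul_mx_scalar !mul_scalar_mx.
  have DZ : p%:Z *: D (- 2 *: t) = D (- (2 * p%:Z) *: t).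
    by rewrite /D -scalemxAr scalerA -scalemxAr; congr (_ *: _); ring.
  by rewrite DZ.
have aD x : a1 *m D x = x + p%:Z ^+ 2 *: (v *m d *m x).
  by rewrite /D !mulmxA Wv !mulmxDl dd mul1mx -!scalemxAl.
set w := z1 *m W *m d.
have bD x : b1 *m D x
    = (p%:Z * (e - 1)) *: (x + p%:Z ^+ 2 *: (v *m d *m x)) + p%:Z ^+ 2 *: (w *m x).
  by rewrite Db1 mulmxDl -!scalemxAl aD /w /D !mulmxA.
(* The factors 2 in [Q] work because $2(e-1) = p - 1$: one has $-2pt + pt - 2p(e-1)t = -p^2 t$ and
   $2p(e-1)t' + pt' = p^2 t'$. The witness collects the quotients by $p^2$. *)
exists (row_mx (row_mx v (- t - (p%:Z * e) *: (2 *: (v *m d *m t)) - 2 *: (w *m t)))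
  (row_mx ((p%:Z * (e - 1)) *: v + z1 *m W)
    (t' + (p%:Z * (e - 1)) *: (2 *: (v *m d *m t')) + 2 *: (w *m t')))).
rewrite /Q !(mul_row_block, mulmx0, mul0mx, mulmx1, addr0, add0r, add_row_mx).
rewrite /eigenvector_nf !scale_row_mx !add_row_mx.
rewrite !aD !bD Wv Db1 mulmxDl -!scalemxAl Wv.
congr (row_mx (row_mx _ _) (row_mx _ _)).
- rewrite Dt -!scalemxAr; move: (v *m d *m t) (w *m t) => x1 x2.
  by apply/rowP=> i; rewrite !mxE pE; ring.
- by rewrite scalerDr !scalerA -!addrA scalerDr !scalerA [p%:Z ^+ 2 * _]mulrC.
- rewrite Dt' -!scalemxAr; move: (v *m d *m t') (w *m t') => x1 x2.
  by apply/rowP=> i; rewrite !mxE pE; ring.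
Qed.

Lemma quasi_idempotent_normal_form (F : fieldType) (p : nat) c g
    (N : 'M[int]_((c.+2 + g) + (c.+2 + g))) :
    p \in [pchar F] -> (0 < g)%N -> N *m N = p%:Z *: N -> \tr N = p%:Z *+ (c.+2 + g) ->
    \rank (map_mx intr N : 'M[F]_((c.+2 + g) + (c.+2 + g))) = c.+2 ->
  exists2 T, T \in unitmx & T *m N = quasi_idempotent_nf c g p *m T.
Proof.
move=> charFp g0 NN trN rkN.
have p0 : p%:Z != 0 by have := prime_gt0 (pcharf_prime charFp); lia.
have [C [T1 uT1 TN1]] := quasi_idempotent_block p0 NN trN.
have rkC : \rank (map_mx intr C : 'M[F]_(c.+2 + g)) = c.+2.
  have defN : N = invmx T1 *m block_mx p%:Z%:M 0 C 0 *m T1 by rewrite -mulmxA -TN1 mulKmx.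
  apply: etrans rkN; rewrite defN mxrank_map_unimodular ?unitmx_inv //.
  rewrite map_block_mx /= map_scalar_mx /=.
  have -> : p%:Z%:~R = 0 :> F by apply/eqP; rewrite (intr_pchar_eq0 charFp) dvdzz.
  by rewrite !map_mx0 raddf0 block_mxEv row_mx0 rank_col_0mx rank_row_mx0.
have [P [Q [X [uP uQ PCQ]]]] := unimodular_rank_normal_form charFp g0 rkC.
(* The diagonal factor turns $C$ into $PCQ$; the shear by $-X$ then subtracts $pX$, the $p$ coming
   from the upper left block. *)
exists (block_mx 1%:M 0 (- X) 1%:M *m block_mx (invmx Q) 0 0 P *m T1).
  rewrite !unitmx_mul uT1 andbT !unitmxE !det_lblock !det1 mul1r unitr1 unitrM.
  by rewrite -!unitmxE unitmx_inv uQ.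
rewrite -!mulmxA TN1 !mulmxA; congr (_ *m _).
have PC : P *m C = (block_mx 1%:M 0 0 0 + p%:Z *: X) *m invmx Q by rewrite -PCQ mulmxK.
rewrite /quasi_idempotent_nf !(mulmx_block, mulmx0, mul0mx, mulmx1, mul1mx, addr0, add0r).
rewrite PC !mul_mx_scalar mul_scalar_mx mulNmx scalerN mulmxDl -scalemxAl.
by rewrite [_ + p%:Z *: _]addrC addKr.
Qed.

(** * Gluing the sum-zero lattice into the full lattice *)

Lemma scalemxI (R : idomainType) m n (a : R) :
  a != 0 -> injective ( *:%R a : 'M[R]_(m, n) -> 'M[R]_(m, n)).
Proof.
by move=> a0 A B /matrixP AB; apply/matrixP=> i j; have := AB i j; rewrite !mxE => /(mulfI a0).
Qed.

(** The first basis vector spans a complement of the sum-zero lattice; the upper right block is the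
    sum-zero part of its image. *)
Definition regular_nf c g (p e : int) :
    'M[int]_(1 + ((c.+2 + g) + (c.+2 + g))) :=
  block_mx (p * e)%:M (row_mx 0 (row_mx ((e * (e - 1)) *: delta_mx 0 0) 0))
           0 (quasi_idempotent_nf c g p).

Lemma eigenvector_nf_mul c g (p e : int) :
  (p * e) *: eigenvector_nf c g p e - eigenvector_nf c g p e *m quasi_idempotent_nf c g p
    = p ^+ 2 *: row_mx 0 (row_mx ((e * (e - 1)) *: delta_mx 0 0) 0).
Proof.
rewrite /eigenvector_nf /quasi_idempotent_nf.
rewrite !(mul_row_block, mulmx0, mulmx1, mul0mx, addr0, mul_mx_scalar).
rewrite !scale_row_mx !(opp_row_mx, add_row_mx) !scaler0 !subr0 !scalerA !addr0.
rewrite -row_mx0; congr (row_mx (row_mx _ _) (row_mx (_ *: _) _)); last by ring.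
  by rewrite -scalerDl -scalerBl (_ : _ - _ = 0) ?scale0r //; ring.
by rewrite subrr.
Qed.

(** These are the rows $e_i - e_0$, the reduction of the integral basis used in
    [regular_normal_form]; this lets the two ranks be compared. *)
Lemma kermx_const1_eqmx (F : fieldType) m :
  (kermx (const_mx 1 : 'cV[F]_(1 + m)) :=: row_mx (- const_mx 1 : 'cV_m) 1%:M)%MS.
Proof.
apply/eqmxP/andP; split; last first.
  rewrite sub_kermx; apply/eqP; rewrite -col_mx_const mul_row_col mul1mx.
  by apply/colP=> i; rewrite !mxE big_ord1 !mxE mulr1 addNr.
set k := kermx _; have : k *m (const_mx 1 : 'cV[F]_(1 + m)) = 0 by apply: mulmx_ker.
rewrite -col_mx_const -(hsubmxK k) mul_row_col.
rewrite (_ : const_mx 1 = 1%:M :> 'M_1); last by apply/matrixP=> i j; rewrite !mxE !ord1.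
rewrite mulmx1 => /eqP; rewrite addr_eq0 => /eqP ->.
by rewrite -mulmxN -[X in row_mx _ X]mulmx1 -mul_mx_row submxMl.
Qed.

(** In the basis $e_0, e_i - e_0$ the matrix is $[[b, w], [0, Y]]$ with $b = pe$. The all-ones
    vector is $p^2 e_0 + y$, so its eigenvector equation reads $p^2 w = b y - yY$: the block $w$ is
    determined by $y$, and $y$ matters only modulo $p^2$ because $e_0$ may be shifted by sum-zero
    vectors. *)
Lemma regular_normal_form (F : fieldType) (p : nat) (e : int) c g
    (N : 'M[int]_(1 + ((c.+2 + g) + (c.+2 + g)))) :
    p \in [pchar F] -> (0 < g)%N -> p%:Z + 1 = e * 2 ->
    (1 + ((c.+2 + g) + (c.+2 + g)) = p ^ 2)%N ->
    N *m const_mx 1 = const_mx (p%:Z * e) :> 'cV_(1 + ((c.+2 + g) + (c.+2 + g))) ->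
    const_mx 1 *m N = const_mx (p%:Z * e) :> 'rV_(1 + ((c.+2 + g) + (c.+2 + g))) ->
    N *m N = p%:Z *: N + const_mx (e * (e - 1)) ->
    \tr N = p%:Z ^+ 2 * e ->
    \rank (kermx (const_mx 1 : 'cV[F]_(1 + ((c.+2 + g) + (c.+2 + g)))) *m map_mx intr N) = c.+2 ->
  exists2 T, T \in unitmx & T *m N = regular_nf c g p e *m T.
Proof.
move=> charFp g0 pe card_eq N1 N1' NN trN.
rewrite (eqmxMr _ (kermx_const1_eqmx _ _)) => rkN.
set m := ((c.+2 + g) + (c.+2 + g))%N in N N1 N1' NN trN rkN card_eq *.
pose one : 'cV[int]_m := const_mx 1.
pose T0 : 'M[int]_(1 + m) := block_mx 1%:M 0 (- one) 1%:M.
pose T0' : 'M[int]_(1 + m) := block_mx 1%:M 0 one 1%:M.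
have T0K : T0 *m T0' = 1%:M.
  rewrite /T0 /T0' !(mulmx_block, mulmx0, mul0mx, mulmx1, mul1mx, addr0, add0r).
  by rewrite addNr -scalar_mx_block.
have [uT0 uT0'] := mulmx1_unit T0K; have T0K' := mulmx1C T0K.
pose w := ursubmx N; pose Y := drsubmx N - one *m w.
pose b := p%:Z * e; pose M0 : 'M[int]_(1 + m) := block_mx b%:M w 0 Y.
have const1E : const_mx 1 = 1%:M :> 'M[int]_1 by apply/matrixP=> i j; rewrite !mxE !ord1.
have T0N : T0 *m N = M0 *m T0.
  have : N *m const_mx 1 = col_mx b%:M (b *: one).
    rewrite N1 -[LHS]col_mx_const; congr col_mx; apply/matrixP=> i j; rewrite !mxE ?mulr1 //.
    by rewrite !ord1.
  rewrite -{1}[N]submxK -[const_mx 1]col_mx_const mul_block_col const1E !mulmx1.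
  rewrite -/w -/one => /eq_col_mx[E1 E2].
  have {}E1 : ulsubmx N = b%:M - w *m one by rewrite -E1 addrK.
  have {}E2 : dlsubmx N = b *: one - drsubmx N *m one by rewrite -E2 addrK.
  rewrite -[X in T0 *m X]submxK /T0 /M0.
  rewrite !(mulmx_block, mulmx0, mul0mx, mulmx1, mul1mx, addr0, add0r).
  rewrite E1 E2 mulmxN; congr block_mx; last by rewrite /Y mulNmx addrC.
  rewrite mulmxBr /Y mulmxN mulmxBl mulNmx mul_mx_scalar mulNmx -mulmxA opprK.
  by rewrite addrC addrACA subrr add0r addrC opprB.
have M0E : M0 = T0 *m N *m T0' by rewrite T0N -mulmxA T0K mulmx1.
(* The all-ones matrix kills sum-zero rows, so in the new basis it only affects the first row. *)
have YY : Y *m Y = p%:Z *: Y.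
  have J1 : const_mx (e * (e - 1)) = (e * (e - 1))
      *: ((const_mx 1 : 'cV_(1 + m)) *m (const_mx 1 : 'rV_(1 + m))) :> 'M[int]_(1 + m).
    by apply/matrixP=> i j; rewrite !mxE big_ord1 !mxE !mulr1.
  have : M0 *m M0 = p%:Z *: M0
      + T0 *m const_mx 1 *m ((e * (e - 1)) *: const_mx 1 *m T0' : 'M_(1, 1 + m)).
    have -> : M0 *m M0 = T0 *m (N *m N) *m T0'.
      by rewrite M0E !mulmxA -(mulmxA _ T0' T0) T0K' mulmx1.
    rewrite NN J1 mulmxDr mulmxDl M0E.
    by rewrite -!(scalemxAr, scalemxAl) !mulmxA.
  have -> : T0 *m const_mx 1 = col_mx 1%:M 0.
    rewrite -[const_mx 1]col_mx_const /T0 mul_block_col const1E mulNmx !mul1mx mulmx1 addNr.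
    by rewrite mul0mx addr0.
  set u := _ *: const_mx 1 *m T0'; rewrite -[u](@hsubmxK _ 1 1 m) mul_col_row !mul0mx.
  rewrite /M0 mulmx_block scale_block_mx add_block_mx => /eq_block_mx[_ _ _].
  by rewrite !(mul0mx, add0r, addr0).
pose y : 'rV[int]_m := const_mx 1.
have wY : p%:Z ^+ 2 *: w + y *m Y = b *: y.
  have yT0' : const_mx 1 *m T0' = row_mx (p%:Z ^+ 2)%:M y :> 'M[int]_(1, 1 + m).
    rewrite -[const_mx 1]row_mx_const const1E mul_row_block !mul1mx !mulmx1 add0r.
    congr row_mx; apply/rowP=> i; rewrite !mxE !ord1 (eq_bigr (fun=> 1)) => [|j _]; last first.
      by rewrite !mxE mulr1.
    by rewrite sumr_const card_ord -[p%:Z]natz -natrX -card_eq natrD.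
  have : const_mx 1 *m T0' *m M0 = b *: (const_mx 1 *m T0') :> 'M[int]_(1, 1 + m).
    rewrite M0E !mulmxA -(mulmxA _ T0' T0) T0K' mulmx1 N1' scalemxAl.
    by congr (_ *m _); apply/rowP=> i; rewrite !mxE mulr1.
  rewrite yT0' mul_row_block scale_row_mx mul_scalar_mx => /eq_row_mx[_ <-].
  by rewrite mul_scalar_mx.
(* The trace is $p^2 e - pe = p(p^2 - 1)/2$, and $p^2 - 1$ is twice [c.+2 + g]. *)
have trY : \tr Y = p%:Z *+ (c.+2 + g).
  have : \tr M0 = p%:Z ^+ 2 * e by rewrite -trN; apply: mxtrace_conj T0N.
  rewrite mxtrace_block mxtrace_scalar mulr1n => trM; apply: (addrI b); rewrite trM /b.
  have eE : e * (p%:Z - 1) * 2 = (p%:Z + 1) * (p%:Z - 1) by rewrite pe; ring.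
  have -> : p%:Z *+ (c.+2 + g) = p%:Z * (e * (p%:Z - 1)).
    by rewrite -mulr_natr; congr (_ * _); move: card_eq eE; rewrite /m; lia.
  by ring.
have rkY : \rank (map_mx intr Y : 'M[F]_m) = c.+2.
  have -> : c.+2 = \rank (map_mx intr (row_mx 0 Y *m T0) : 'M[F]_(m, 1 + m)).
    rewrite -[LHS]rkN; congr (\rank _).
    have <- : dsubmx T0 *m N = row_mx 0 Y *m T0.
      by rewrite mul_dsub_mx T0N -mul_dsub_mx /M0 block_mxEv col_mxKd.
    rewrite map_mxM; congr (_ *m _).
    by rewrite /T0 block_mxEv col_mxKd map_row_mx map_mxN map_const_mx map_mx1 rmorph1.
  rewrite map_mxM mxrankMfree ?row_free_unit ?map_mx_unitmx // map_row_mx map_mx0.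
  by rewrite rank_row_0mx.
have [T1 uT1 T1Y] := quasi_idempotent_normal_form charFp g0 YY trY rkY.
have uT1' : invmx T1 \in unitmx by rewrite unitmx_inv.
have yT1 : y *m invmx T1 *m quasi_idempotent_nf c g p
    = b *: (y *m invmx T1) + p%:Z ^+ 2 *: - (w *m invmx T1).
  rewrite -(mulmxK uT1 (quasi_idempotent_nf c g p)) -T1Y !mulmxA mulmxKV //.
  rewrite -(addKr (p%:Z ^+ 2 *: w) (y *m Y)) wY.
  by rewrite mulmxDl mulNmx -!scalemxAl scalerN addrC.
have nzy : map_mx intr (y *m invmx T1) != 0 :> 'rV[F]_m.
  apply/eqP=> yT10; have : map_mx intr y = 0 :> 'rV[F]_m.
    by rewrite -(mulmxKV uT1 y) map_mxM yT10 mul0mx.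
  move/rowP/(_ (lshift _ (lshift _ 0))); rewrite !mxE => /eqP.
  by rewrite rmorph1 oner_eq0.
have [Q uQ [QK [z yQ]]] := eigenvector_normal_form charFp pe yT1 nzy.
pose T3 := invmx Q *m T1; pose z0 := z *m T3.
have uT3 : T3 \in unitmx by rewrite unitmx_mul unitmx_inv uQ.
have T3Y : T3 *m Y = quasi_idempotent_nf c g p *m T3.
  rewrite /T3 -mulmxA T1Y !mulmxA; congr (_ *m _).
  by rewrite -[LHS](mulmxK uQ) -(mulmxA (invmx Q)) -QK mulKmx.
have yE : y = eigenvector_nf c g p e *m T3 + p%:Z ^+ 2 *: z0.
  by rewrite /z0 scalemxAl -mulmxDl -yQ /T3 !mulmxA mulmxK // mulmxKV.
clearbody z0 T3.
(* Replacing $e_0$ by $e_0 + z_0$ subtracts $p^2 z_0$ from $y$, which leaves exactly the standard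
   vector; [eigenvector_nf_mul] then gives the upper right block. *)
exists (block_mx 1%:M z0 0 T3 *m T0).
  by rewrite unitmx_mul uT0 unitmxE det_ublock det1 mul1r -unitmxE uT3.
rewrite -mulmxA T0N !mulmxA; congr (_ *m _).
rewrite /M0 /regular_nf !(mulmx_block, mulmx0, mul0mx, mulmx1, mul1mx, addr0, add0r).
rewrite T3Y mul_scalar_mx; congr block_mx.
have p20 : p%:Z ^+ 2 != 0 :> int.
  by rewrite expf_neq0 //; have := prime_gt0 (pcharf_prime charFp); lia.
apply: (scalemxI p20); rewrite !scalerDr [X in _ = _ + X]scalemxAl -eigenvector_nf_mul.
rewrite -/b mulmxBl -mulmxA -T3Y mulmxA -scalemxAl.
have -> : p%:Z ^+ 2 *: w = b *: y - y *m Y by rewrite -wY addrK.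
rewrite yE mulmxDl scalerDr -!scalemxAl !scalerA [b * _]mulrC.
by rewrite opprD addrA subrK addrAC addrC.
Qed.

(** * Unions of lines in the affine plane *)

(** When $D$ is the union of $e$ punctured lines, this is the sum of the indicators of the full
    lines, all of which contain 0. *)
Definition shifted_indicator (F : finFieldType) e (D : {set F}) (z : F) : nat :=
  (z \in D) + e * (z == 0).

Section LineUnions.

Variables (F : finFieldType) (p : nat).
Hypotheses (charFp : p \in [pchar F]) (cardF : #|F| = (p ^ 2)%N).

(** The prime field, as the fixed points of Frobenius. *)
Let K : {set F} := [set x | x ^+ p == x].

Let inK x : (x \in K) = (x ^+ p == x). Proof. by rewrite inE. Qed.

Let KB : {in K &, forall x y, x - y \in K}.
Proof.
move=> x y; rewrite !inK => /eqP xp /eqP yp.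
by rewrite -(pFrobenius_autE charFp) rmorphB /= !pFrobenius_autE xp yp.
Qed.

Let KD : {in K &, forall x y, x + y \in K}.
Proof.
move=> x y; rewrite !inK => /eqP xp /eqP yp.
by rewrite -(pFrobenius_autE charFp) rmorphD /= !pFrobenius_autE xp yp.
Qed.

Let KM : {in K &, forall x y, x * y \in K}.
Proof. by move=> x y; rewrite !inK exprMn => /eqP-> /eqP->. Qed.

Let KV : {in K, forall x, x^-1 \in K}.
Proof. by move=> x; rewrite !inK exprVn => /eqP->. Qed.

Let K0 : 0 \in K.
Proof. by rewrite inK expr0n -[p == 0%N]negbK -lt0n (prime_gt0 (pcharf_prime charFp)). Qed.

Let cardK : #|K| = p.
Proof.
have p_pr := pcharf_prime charFp; have p1 := prime_gt1 p_pr.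
apply/eqP; rewrite eqn_leq; apply/andP; split.
  have szP : size ('X^p - 'X : {poly F}) = p.+1.
    by rewrite size_polyDl ?size_polyXn // size_polyN size_polyX ltnS.
  have := @max_poly_roots _ ('X^p - 'X : {poly F}) (enum K); rewrite szP ltnS -cardE; apply.
  - by rewrite -size_poly_eq0 szP.
  - by apply/allP=> x; rewrite mem_enum inK rootE !hornerE subr_eq0.
  - exact: enum_uniq.
have inj : injective (fun i : 'I_p => (val i)%:R : F).
  move=> i j ij; apply: val_inj.
  wlog ltij : i j ij / (i <= j)%N.
    by move=> W; case/orP: (leq_total i j) => ?; [exact: W | symmetry; exact: W].
  have : (p %| val j - val i)%N by rewrite (dvdn_pcharf charFp) natrB // ij subrr.
  case: (posnP (val j - val i)%N) => [/eqP|gt0].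
    by rewrite subn_eq0 => ji _; apply/eqP; rewrite eqn_leq ltij.
  by move/(dvdn_leq gt0); rewrite leqNgt (leq_ltn_trans (leq_subr _ _) (ltn_ord j)).
rewrite -[X in (X <= _)%N]card_ord -(card_imset _ inj).
apply/subset_leq_card/subsetP=> _ /imsetP[i _ ->].
by rewrite inK -(pFrobenius_autE charFp) rmorph_nat.
Qed.

Let line (t z : F) : bool := z / t \in K.

Let line_trans (s t z : F) : s != 0 -> t != 0 -> s / t \in K -> line s z = line t z.
Proof.
move=> s0 t0 st; rewrite /line.
have ts : t / s \in K by rewrite -invf_div KV.
apply/idP/idP=> H.
  by have := KM H st; rewrite mulrA mulfVK.
by have := KM H ts; rewrite mulrA mulfVK.
Qed.

Let card_line (t : F) : t != 0 -> (\sum_z line t z)%N = p.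
Proof.
move=> t0; rewrite -cardK -sum1_card [RHS]big_mkcond /=.
rewrite [LHS](reindex (fun x => x * t)) /=; last first.
  by exists (fun x => x / t) => x _; rewrite ?mulfK ?mulfVK.
by apply: eq_bigr => x _; rewrite /line mulfK //; case: (x \in K).
Qed.

Let conv_line_same (t z : F) : t != 0 -> (\sum_w line t w * line t (z - w)%R)%N = (p * line t z)%N.
Proof.
move=> t0; have [zt|nzt] := boolP (line t z).
  rewrite muln1 -(card_line t0); apply: eq_bigr => w _.
  have [wt|] := boolP (line t w); last by [].
  by rewrite /line mulrBl KB.
rewrite muln0 big1 // => w _; have [wt|] := boolP (line t w); last by [].
have [zt|] := boolP (line t (z - w)); last by [].
by case/negP: nzt; have := KD zt wt; rewrite -mulrDl subrK.
Qed.

(** The map $(a, b) \mapsto as + bt$ is injective on $K \times K$, hence onto since $|F| = p^2$; so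
    $z$ splits in exactly one way. *)
Let conv_line_diff (s t z : F) : s != 0 -> t != 0 -> s / t \notin K ->
  (\sum_w line s w * line t (z - w)%R)%N = 1%N.
Proof.
move=> s0 t0 nst.
pose f (ab : F * F) := ab.1 * s + ab.2 * t.
have f_inj : {in setX K K &, injective f}.
  move=> [a b] [a' b']; rewrite !in_setX /= => /andP[aK bK] /andP[aK' bK'] E.
  have {}E : (a - a') * s = (b' - b) * t.
    have {}E : a * s + b * t = a' * s + b' * t := E.
    by transitivity (a * s + b * t - a' * s - b * t); [ring | rewrite E; ring].
  have [aa|aa] := eqVneq a a'.
    move/eqP: E; rewrite aa subrr mul0r eq_sym mulf_eq0 (negPf t0) orbF subr_eq0.
    by move/eqP->.
  case/negP: nst; have -> : s / t = (b' - b) / (a - a').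
    by apply/eqP; rewrite eqr_div ?subr_eq0 // mulrC E.
  by rewrite KM ?KB ?KV ?KB.
have : z \in f @: setX K K.
  have -> : f @: setX K K = [set: F]; last by rewrite inE.
  apply/eqP; rewrite eqEcard subsetT card_in_imset //.
  by rewrite cardsX cardK cardsT mulnn -cardF leqnn.
case/imsetP=> [[a b]]; rewrite in_setX /= => /andP[aK bK] zE.
rewrite (bigD1 (a * s)) //= big1 => [|w wa].
  by rewrite zE /f /= addrAC subrr add0r /line !mulfK // aK bK.
have [ws|] := boolP (line s w); last by [].
have [zt|] := boolP (line t (z - w)); last by [].
case/eqP: wa; suff [-> _] : (a, b) = (w / s, (z - w) / t) by rewrite divfK.
apply: f_inj; rewrite ?in_setX ?aK //; first by apply/andP.
by rewrite -zE /f /= !divfK // addrC subrK.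
Qed.

Variables (e : nat) (D : {set F}).
Hypotheses (D0 : 0 \notin D) (cardD : #|D| = (p.-1 * e)%N).
Hypothesis DK : {in D, forall x y, y ^+ p = y -> y != 0 -> x * y \in D}.

Local Notation f := (shifted_indicator e D).

(* Every line meeting D is counted once for each of its p - 1 nonzero points; this avoids choosing
   representatives of the lines contained in D. *)
Let sum_line z : (\sum_(t in D) line t z)%N = (p.-1 * f z)%N.
Proof.
have [->|z0] := eqVneq z 0.
  rewrite /shifted_indicator (negPf D0) eqxx muln1 add0n -cardD -sum1_card; apply: eq_bigr => t _.
  by rewrite /line mul0r K0.
rewrite /shifted_indicator (negPf z0) muln0 addn0.
have cK : #|K :\ 0| = p.-1 by rewrite -cardK (cardsD1 0 K) K0.
rewrite -cK -sum1_card big_distrl /= big_mkcond /= [RHS]big_mkcond /=.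
rewrite [LHS](reindex (fun x => z / x)) /=; last first.
  by exists (fun x => z / x) => x _; rewrite invf_div mulrCA divff // mulr1.
apply: eq_bigr => x _; rewrite in_setD1.
have [->|x0] /= := eqVneq x 0; first by rewrite invr0 mulr0 (negPf D0).
rewrite /line invf_div mulrCA divff // mulr1 mul1n.
have [xK|] := boolP (x \in K); last by rewrite if_same.
suff -> : (z / x \in D) = (z \in D) by case: (z \in D).
have xp : x ^+ p = x by apply/eqP; rewrite -inK.
apply/idP/idP=> H; last by apply: DK; rewrite ?invr_eq0 ?exprVn ?xp.
by rewrite -(divfK x0 z) DK.
Qed.

(** A line convolved with itself is $p$ times itself; two distinct lines convolve to the constant 1.
    Both sides are multiplied by $(p-1)^2$ in order to sum over pairs of points of $D$. *)
Lemma line_union_convolution z : (\sum_w f w * f (z - w)%R)%N = (p * f z + e * e.-1)%N.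
Proof.
have p_gt1 := prime_gt1 (pcharf_prime charFp).
have P2 : (0 < p.-1 ^ 2)%N by rewrite expn_gt0 -subn1 subn_gt0 p_gt1.
apply/eqP; rewrite -(eqn_pmul2l P2) big_distrr /=; apply/eqP.
transitivity (\sum_(t in D) \sum_(s in D) \sum_w line s w * line t (z - w)%R)%N.
  rewrite (eq_bigr (fun w => \sum_(s in D) \sum_(t in D) line s w * line t (z - w)%R)%N) => [|w _].
    rewrite exchange_big /= [RHS]exchange_big /=; apply: eq_bigr => s _.
    by rewrite exchange_big.
  by rewrite expnS expn1 mulnACA -!sum_line big_distrlr.
have nz t : t \in D -> t != 0 by apply: contraTneq => ->.
transitivity (\sum_(t in D) (p.-1 * p * line t z + (#|D| - p.-1)))%N.
  apply: eq_bigr => t tD.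
  rewrite (bigID (fun s => s / t \in K)) /= (eq_bigr (fun=> p * line t z)%N) => [|s /andP[sD st]].
    rewrite [X in (_ + X)%N](eq_bigr (fun=> 1%N)) => [|s /andP[sD st]]; last first.
      by rewrite conv_line_diff ?nz.
    (* [sum_line] at the point [t] itself counts the points of $D$ on its line. *)
    have cP : (\sum_(s in D | (s / t)%R \in K) 1)%N = p.-1.
      have := sum_line t; rewrite /shifted_indicator tD (negPf (nz t tD)) muln0 addn0 muln1 => <-.
      rewrite big_mkcondr; apply: eq_bigr => s sD; rewrite /line -[t / s]invf_div.
      rewrite (_ : (_^-1 \in K) = (s / t \in K)); last first.
        by apply/idP/idP=> /KV; rewrite ?invrK.
      by case: (_ \in K).
    rewrite -[#|D|]sum1_card [X in (_ = _ + (X - _))%N](bigID (fun s => s / t \in K)) /= cP addKn.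
    by rewrite sum_nat_const -sum1_card cP mulnA.
  rewrite -(conv_line_same _ (nz t tD)); apply: eq_bigr => w _; congr (_ * _)%N.
  by rewrite (line_trans _ _ _ st) ?nz.
rewrite big_split /= -big_distrr /= sum_line sum_nat_const cardD.
have -> : (p.-1 * e - p.-1 = p.-1 * e.-1)%N by rewrite -{2}[p.-1]muln1 -mulnBr subn1.
by ring.
Qed.

Lemma line_union_sum : (\sum_z f z)%N = (p * e)%N.
Proof.
rewrite big_split /= -big_distrr /= [X in (_ + e * X)%N](bigD1 0) //= eqxx.
rewrite [X in (_ + e * (_ + X))%N]big1 => [|z /negPf-> //]; rewrite addn0 muln1.
have -> : (\sum_z (z \in D))%N = #|D| by rewrite -sum1_card [RHS]big_mkcond.
by rewrite cardD addnC -mulSn prednK ?prime_gt0 ?(pcharf_prime charFp).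
Qed.

End LineUnions.

(** * Ranks of translation kernels in characteristic p *)

Lemma sum_enum_val (V : nmodType) (T : finType) (E : T -> V) :
  \sum_(i < #|T|) E (enum_val i) = \sum_t E t.
Proof.
rewrite [RHS](reindex (fun i : 'I_#|T| => enum_val i)) //=.
by exists enum_rank => x _; rewrite ?enum_valK ?enum_rankK.
Qed.

(** The rows in [R0] span the row space, and on the columns [phi] of [R0] they form an invertible
    diagonal matrix. *)
Lemma mxrank_sparse (F : fieldType) (T : finType) (B : T -> T -> F) (R0 : {set T}) (phi : T -> T) :
    (forall r, r \in R0 -> B r (phi r) != 0) ->
    {in R0 &, forall r s, r != s -> B r (phi s) = 0} ->
    (forall r, r \notin R0 -> (forall t, B r t = 0)
        \/ exists s k, s \in R0 /\ forall t, B r t = k * B s t) ->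
  \rank (\matrix_(i < #|T|, j < #|T|) B (enum_val i) (enum_val j)) = #|R0|.
Proof.
move=> Bdiag Boff Bspan; set M := \matrix_(i, j) _.
pose f (i : 'I_#|R0|) : 'I_#|T| := enum_rank (enum_val i).
pose g (i : 'I_#|R0|) : 'I_#|T| := enum_rank (phi (enum_val i)).
apply/eqP; rewrite eqn_leq; apply/andP; split.
  apply: leq_trans (rank_leq_row (rowsub f M)); apply/mxrankS/row_subP=> i.
  have [iR|/Bspan] := boolP (enum_val i \in R0).
    apply: (eq_row_sub (enum_rank_in iR (enum_val i))); apply/rowP=> j.
    by rewrite !mxE enum_rankK enum_rankK_in.
  case=> [Bi0 | [s [k [sR Bs]]]].
    by rewrite (_ : row i M = 0) ?sub0mx //; apply/rowP=> j; rewrite !mxE Bi0.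
  rewrite (_ : row i M = k *: row (enum_rank_in sR s) (rowsub f M)) ?scalemx_sub ?row_sub //.
  by apply/rowP=> j; rewrite !mxE Bs enum_rankK enum_rankK_in.
have <- : \rank (mxsub f g M) = #|R0|.
  have -> : mxsub f g M = diag_mx (\row_i B (enum_val i) (phi (enum_val i))).
    apply/matrixP=> i j; rewrite !mxE !enum_rankK.
    have [->|ij] := eqVneq i j; first by rewrite mulr1n.
    by rewrite mulr0n Boff ?enum_valP // (inj_eq enum_val_inj).
  apply: mxrank_unit; rewrite unitmxE det_diag unitfE prodf_seq_neq0.
  by apply/allP=> i _ /=; rewrite mxE Bdiag ?enum_valP.
rewrite -[M]mulmx1 mxsub_mul; apply: leq_trans (mxrankM_maxl _ _) (mxrankS _).
by rewrite mulmx1 rowsub_sub.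
Qed.

Lemma prime_ndvd_fact p n : prime p -> (n < p)%N -> ~~ (p %| n`!)%N.
Proof.
move=> p_pr; elim: n => [|n IHn] np; first by rewrite fact0 dvdn1 neq_ltn prime_gt1 ?orbT.
by rewrite factS Euclid_dvdM // negb_or IHn ?(ltnW np) // gtnNdvd.
Qed.

Lemma card_ord_lt n k : (k <= n)%N -> #|[set i : 'I_n | (i < k)%N]| = k.
Proof. by move=> kn; rewrite -sum1dep_card (big_ord_narrow kn) sum1_card card_ord. Qed.

Section TranslationKernels.

Variables (F : finFieldType) (p : nat).
Hypotheses (charFp : p \in [pchar F]) (cardF : #|F| = (p ^ 2)%N).

Let p_gt0 : (0 < p)%N. Proof. exact: prime_gt0 (pcharf_prime charFp). Qed.

Definition binomial_coeff (a i j : nat) : F :=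
  if (i + j == a)%N then (-1) ^+ j * 'C(a, j)%:R else 0.

Lemma binomial_coeff_neq0 a i j :
  (a < p)%N -> (binomial_coeff a i j != 0) = (i + j == a)%N.
Proof.
move=> ap; rewrite /binomial_coeff; case: ifP => [/eqP ija|_]; last by rewrite eqxx.
rewrite mulf_neq0 ?signr_eq0 // -(dvdn_pcharf charFp).
have : ~~ (p %| a`!)%N by apply: prime_ndvd_fact; rewrite ?(pcharf_prime charFp).
by apply: contra; rewrite -(@bin_fact a j) -?ija ?leq_addl //; apply: dvdn_mulr.
Qed.

Lemma exprB_binomial_coeff (x y : F) a : (a < p)%N ->
  (x - y) ^+ a = \sum_(i < p) \sum_(j < p) binomial_coeff a i j * x ^+ i * y ^+ j.
Proof.
move=> ap; rewrite exprBn exchange_big /=.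
rewrite (big_ord_widen _ (fun j => ((-1) ^+ j * x ^+ (a - j) * y ^+ j) *+ 'C(a, j)) ap).
rewrite big_mkcond; apply: eq_bigr => j _ /=; case: ifP => ja.
  have ajp : (a - j < p)%N := leq_ltn_trans (leq_subr _ _) ap.
  rewrite (bigD1 (Ordinal ajp)) //= big1 => [|i ia].
    rewrite addr0 /binomial_coeff subnK // eqxx -mulr_natr; ring.
  rewrite /binomial_coeff ifF ?mul0r //; apply/eqP=> ija; case/eqP: ia.
  by apply: val_inj; rewrite /= -ija addnK.
rewrite big1 // => i _; rewrite /binomial_coeff ifF ?mul0r //.
by apply/negP=> /eqP ija; move: ja; rewrite ltnS -ija leq_addl.
Qed.

(** Exponents below $p^2$ are kept as pairs of base-$p$ digits, since Frobenius separates the two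
    digits. *)
Definition monomial_degree (I : 'I_p * 'I_p) : nat := (I.1 + p * I.2)%N.

Lemma monomial_degree_inj : injective monomial_degree.
Proof.
move=> [i j] [i' j'] /= E; have Ei : i = i' :> nat.
  have := congr1 (modn^~ p) E; rewrite /monomial_degree /= ![(p * _)%N]mulnC ![(_ + _ * p)%N]addnC.
  by rewrite !modnMDl !modn_small.
have Ej : j = j' :> nat.
  by move/eqP: E; rewrite /monomial_degree /= Ei eqn_add2l eqn_pmul2l // => /eqP.
by congr (_, _); apply: val_inj.
Qed.

Lemma monomial_degree_lt I : (monomial_degree I < p ^ 2)%N.
Proof.
case: I => [[i ip] [j jp]]; rewrite /monomial_degree /= expnS expn1.
have : (p * j.+1 <= p * p)%N by rewrite leq_mul2l jp orbT.
by rewrite mulnS; apply: leq_trans; rewrite ltn_add2r.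
Qed.

Definition monomial_mx : 'M[F]_(#|{: 'I_p * 'I_p}|, #|F|) :=
  \matrix_(I, x) enum_val x ^+ monomial_degree (enum_val I).

(** A nonzero polynomial of degree below $p^2$ cannot vanish on all of $F$. *)
Lemma monomial_mx_free : row_free monomial_mx.
Proof.
apply: inj_row_free => v v0.
pose P : {poly F} := \sum_(I < #|{: 'I_p * 'I_p}|) v 0 I *: 'X^(monomial_degree (enum_val I)).
have P0 : P = 0.
  apply/eqP; apply: contraT => nzP.
  have := max_poly_roots nzP _ (enum_uniq F); rewrite -cardE.
  have -> : all (root P) (enum F).
    apply/allP=> x _; rewrite rootE horner_sum.
    have := congr1 (fun u : 'rV_#|F| => u 0 (enum_rank x)) v0.
    rewrite !mxE => E; apply/eqP; rewrite -[RHS]E; apply: eq_bigr => I _.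
    by rewrite !hornerE mxE enum_rankK.
  move=> /(_ isT); rewrite ltnNge; apply: contraNT => _.
  rewrite cardF; apply: (leq_trans (size_sum _ _ _)); apply/bigmax_leqP=> I _.
  by apply: leq_trans (size_scale_leq _ _) _; rewrite size_polyXn monomial_degree_lt.
apply/rowP=> I; rewrite mxE.
have := congr1 (fun Q : {poly F} => Q`_(monomial_degree (enum_val I))) P0.
rewrite coef0 coef_sum (bigD1 I) //= big1 => [|J JI].
  by rewrite addr0 coefZ coefXn eqxx mulr1.
rewrite coefZ coefXn eq_sym (inj_eq monomial_degree_inj) (inj_eq enum_val_inj).
by rewrite (negPf JI) mulr0.
Qed.

(** In the invertible monomial basis $G = V^T M V$, and the all-ones column is $V^T$ applied to the
    unit vector of the constant monomial. Restricting to sum-zero rows therefore deletes the row of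
    that monomial from $M$. *)
Lemma mxrank_translation_kernel (B : 'I_p * 'I_p -> 'I_p * 'I_p -> F) (G : 'M[F]_#|F|) :
    (forall i j, G i j = \sum_I \sum_J B I J
       * enum_val i ^+ monomial_degree I * enum_val j ^+ monomial_degree J) ->
  \rank (kermx (const_mx 1 : 'cV[F]_#|F|) *m G)
    = \rank (\matrix_(I < #|{: 'I_p * 'I_p}|, J < #|{: 'I_p * 'I_p}|)
        (if monomial_degree (enum_val I) == 0%N then 0 else B (enum_val I) (enum_val J))).
Proof.
move=> GE; set V := monomial_mx; set n := #|{: 'I_p * 'I_p}|.
pose M : 'M[F]_n := \matrix_(I, J) B (enum_val I) (enum_val J).
pose nz (I : 'I_n) := (monomial_degree (enum_val I) != 0)%N.
pose Z : 'M[F]_n := \matrix_(I, J) ((I == J) && nz J)%:R.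
have -> : G = V^T *m M *m V.
  apply/matrixP=> i j; rewrite GE exchange_big -sum_enum_val mxE /=.
  apply: eq_bigr => J _; rewrite mxE big_distrl -sum_enum_val /=; apply: eq_bigr => I _.
  by rewrite !mxE [_ * B _ _]mulrC.
rewrite !mulmxA mxrankMfree ?monomial_mx_free //.
have ZM : Z *m M = \matrix_(I, J)
    (if monomial_degree (enum_val I) == 0%N then 0 else B (enum_val I) (enum_val J)).
  apply/matrixP=> I J; rewrite !mxE (bigD1 I) //= big1 => [|K KI]; last first.
    by rewrite mxE eq_sym (negPf KI) mul0r.
  rewrite addr0 !mxE eqxx /nz /=; case: eqP => _; by rewrite ?mul0r ?mul1r.
rewrite -ZM; set W := kermx _ *m V^T.
suff WZ : (W :=: Z)%MS by rewrite (eqmxMr M WZ).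
pose e0 : 'cV[F]_n := \col_I (monomial_degree (enum_val I) == 0%N)%:R.
pose I0 : 'I_p * 'I_p := (Ordinal p_gt0, Ordinal p_gt0).
have deg0 I : (monomial_degree I == 0%N) = (I == I0).
  by rewrite -(inj_eq monomial_degree_inj) /monomial_degree /= muln0.
have Ve0 : V^T *m e0 = const_mx 1.
  apply/colP=> x; rewrite !mxE (bigD1 (enum_rank I0)) //= big1 => [|K KI].
    by rewrite !mxE enum_rankK deg0 eqxx mulr1 /monomial_degree /= muln0 addr0 expr0.
  by rewrite !mxE deg0 -(inj_eq enum_rank_inj) enum_valK (negPf KI) mulr0.
apply/eqmxP/andP; split.
  have -> : W = W *m Z; last exact: submxMl.
  have We0 : W *m e0 = 0 by rewrite -mulmxA Ve0 mulmx_ker.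
  apply/matrixP=> i J; rewrite [RHS]mxE (bigD1 J) //= big1 => [|K KJ].
    rewrite addr0 [Z J J]mxE eqxx /nz /=; case: eqP => [J0|_]; last by rewrite mulr1.
    have /matrixP/(_ i 0) := We0; rewrite mxE [RHS]mxE (bigD1 J) //= big1 => [|K KJ].
      by rewrite addr0 [e0 J 0]mxE J0 eqxx mulr1 mulr0 => ->.
    have -> : e0 K 0 = 0; last by rewrite mulr0.
    rewrite mxE -J0 (inj_eq monomial_degree_inj) (inj_eq enum_val_inj).
    by rewrite (negPf KJ).
  by rewrite [Z K J]mxE (negPf KJ) mulr0.
have /row_fullP[V' V'V] : row_full V^T by rewrite /row_full mxrank_tr; apply: monomial_mx_free.
have -> : Z = (Z *m V') *m V^T by rewrite -mulmxA V'V mulmx1.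
apply: submxMr; rewrite sub_kermx -Ve0 mulmxA -(mulmxA Z) V'V mulmx1; apply/eqP.
apply/colP=> I; rewrite !mxE big1 // => J _; rewrite !mxE /nz.
by case: (monomial_degree _ == 0%N); rewrite ?andbF ?mul0r ?mulr0.
Qed.

Definition box_coeff a a' (I J : 'I_p * 'I_p) : F :=
  binomial_coeff a I.1 J.1 * binomial_coeff a' I.2 J.2.

Lemma box_coeff_neq0 a a' (I J : 'I_p * 'I_p) : (a < p)%N -> (a' < p)%N ->
  (box_coeff a a' I J != 0) = ((I.1 + J.1 == a) && (I.2 + J.2 == a'))%N.
Proof. by move=> ap ap'; rewrite mulf_eq0 negb_or !binomial_coeff_neq0. Qed.

Lemma box_coeff_eq0 a a' (I J : 'I_p * 'I_p) : (a < p)%N -> (a' < p)%N ->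
  ~~ ((I.1 + J.1 == a) && (I.2 + J.2 == a'))%N -> box_coeff a a' I J = 0.
Proof. by move=> ap ap'; rewrite -box_coeff_neq0 // negbK => /eqP. Qed.

Lemma exprB_box_coeff (x y : F) a a' : (a < p)%N -> (a' < p)%N ->
  (x - y) ^+ (a + p * a') = \sum_I \sum_J box_coeff a a' I J
       * x ^+ monomial_degree I * y ^+ monomial_degree J.
Proof.
move=> ap ap'; rewrite exprD exprM -(pFrobenius_autE charFp) rmorphB /= !pFrobenius_autE.
rewrite (exprB_binomial_coeff x y ap) (exprB_binomial_coeff _ _ ap').
rewrite big_distrlr pair_big /=; apply: eq_bigr => I _.
rewrite big_distrlr pair_big /=; apply: eq_bigr => J _.
by rewrite /box_coeff /monomial_degree !exprD !exprM; ring.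
Qed.

(** The constant [c0] contributes only to the entry at the pair of constant monomials, which lies in
    the deleted row. *)
Lemma mxrank_box_kernel (G : 'M[F]_#|F|) c0 c1 c2 a1 b1 a2 b2 :
    (a1 < p)%N -> (b1 < p)%N -> (a2 < p)%N -> (b2 < p)%N ->
    (forall i j, G i j = c0 + c1 * (enum_val i - enum_val j) ^+ (a1 + p * b1)
       + c2 * (enum_val i - enum_val j) ^+ (a2 + p * b2)) ->
  \rank (kermx (const_mx 1 : 'cV[F]_#|F|) *m G)
    = \rank (\matrix_(I < #|{: 'I_p * 'I_p}|, J < #|{: 'I_p * 'I_p}|)
        (if monomial_degree (enum_val I) == 0%N then 0 else
         c1 * box_coeff a1 b1 (enum_val I) (enum_val J)
         + c2 * box_coeff a2 b2 (enum_val I) (enum_val J))).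
Proof.
move=> a1p b1p a2p b2p GE.
pose B I J : F := (if (monomial_degree I + monomial_degree J == 0)%N then c0 else 0)
  + c1 * box_coeff a1 b1 I J + c2 * box_coeff a2 b2 I J.
rewrite (@mxrank_translation_kernel B) => [|i j].
  congr (\rank _); apply/matrixP=> I J; rewrite !mxE /B.
  by case: ifP => // I0; rewrite addn_eq0 I0 add0r.
pose I0 : 'I_p * 'I_p := (Ordinal p_gt0, Ordinal p_gt0).
have deg0 I : (monomial_degree I == 0%N) = (I == I0).
  by rewrite -(inj_eq monomial_degree_inj) /monomial_degree /= muln0.
have E0 : \sum_I \sum_J (if (monomial_degree I + monomial_degree J == 0)%N then c0 else 0)
    * enum_val i ^+ monomial_degree I * enum_val j ^+ monomial_degree J = c0.
  rewrite (bigD1 I0) //= [X in _ + X]big1 => [|I II]; last first.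
    by apply: big1 => J _; rewrite addn_eq0 deg0 (negPf II) !mul0r.
  rewrite addr0 (bigD1 I0) //= big1 => [|I II]; last first.
    by rewrite addn_eq0 andbC deg0 (negPf II) !mul0r.
  by rewrite addr0 /monomial_degree /= !muln0 !addn0 !expr0 !mulr1.
rewrite GE !exprB_box_coeff // -{1}E0 !big_distrr -!big_split /=.
apply: eq_bigr => I _; rewrite !big_distrr -!big_split /=.
by apply: eq_bigr => J _; rewrite /B !mulrDl !mulrA.
Qed.

Lemma card_box m n : (m <= p)%N -> (n <= p)%N ->
  #|[set I : 'I_p * 'I_p | (I.1 < m)%N && (I.2 < n)%N]| = (m * n)%N.
Proof.
move=> mp np; rewrite -{2}(card_ord_lt mp) -{2}(card_ord_lt np) -cardsX; congr #|pred_of_set _|.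
by apply/setP=> [[i j]]; rewrite !inE.
Qed.

(** * The two p-ranks *)

Variable h : nat.
Hypotheses (h_gt0 : (0 < h)%N) (ph : p.+1 = (4 * h)%N).

Let o (m : nat) : 'I_p := Ordinal (ltn_pmod m p_gt0).

Let oE m : (m < p)%N -> o m = m :> nat.
Proof. exact: modn_small. Qed.

(** A row in $[0,2h)^2$ has its only nonzero entry at the complementary digits, and all other rows
    vanish. Deleting the origin leaves $4h^2 - 1$ rows. *)
Lemma mxrank_paley_kernel (G : 'M[F]_#|F|) c0 c1 : c1 != 0 ->
    (forall i j, G i j = c0 + c1 * (enum_val i - enum_val j) ^+ ((2 * h).-1 + p * (2 * h).-1)) ->
  \rank (kermx (const_mx 1 : 'cV[F]_#|F|) *m G) = (4 * h ^ 2).-1%N.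
Proof.
move=> nzc1 GE.
have ap : ((2 * h).-1 < p)%N by lia.
rewrite (@mxrank_box_kernel _ c0 c1 0 (2 * h).-1 (2 * h).-1 (2 * h).-1 (2 * h).-1) //; last first.
  by move=> i j; rewrite GE mul0r addr0.
pose B I J : F := if monomial_degree I == 0%N then 0 else
  c1 * box_coeff (2 * h).-1 (2 * h).-1 I J + 0 * box_coeff (2 * h).-1 (2 * h).-1 I J.
pose R0 := [set I : 'I_p * 'I_p | ((I.1 < 2 * h) && (I.2 < 2 * h))%N] :\ (o 0, o 0).
pose phi (I : 'I_p * 'I_p) := (o ((2 * h).-1 - I.1), o ((2 * h).-1 - I.2)).
have deg0 I : (monomial_degree I == 0%N) = (I == (o 0, o 0)).
  by rewrite -(inj_eq monomial_degree_inj) /monomial_degree /= mod0n muln0.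
rewrite -[LHS]/(\rank (\matrix_(I, J) B (enum_val I) (enum_val J))).
rewrite (@mxrank_sparse _ _ B R0 phi).
- have := cardsD1 (o 0, o 0) [set I : 'I_p * 'I_p | ((I.1 < 2 * h) && (I.2 < 2 * h))%N].
  rewrite card_box ?inE /= ?mod0n ?muln_gt0 ?h_gt0; try lia.
  rewrite -/R0; nia.
- move=> [i j]; rewrite !inE /B deg0 /= => /andP[/negPf-> /andP[i2 j2]].
  rewrite mul0r addr0 mulf_neq0 // box_coeff_neq0 // /phi !oE /=; lia.
- move=> [i j] [i' j']; rewrite !inE /B deg0 /= => /andP[/negPf-> /andP[i2 j2]].
  move=> /andP[_ /andP[i2' j2']] ne.
  rewrite mul0r addr0 box_coeff_eq0 ?mulr0 // /phi !oE /=; try lia.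
  apply: contra ne => /andP[/eqP E1 /eqP E2].
  by apply/eqP; congr (_, _); apply: val_inj => /=; lia.
move=> [i j]; rewrite !inE /B deg0 /= negb_and negbK => /orP[->|nb]; first by left.
left=> [[i' j']]; case: ifP => // _; rewrite mul0r addr0 box_coeff_eq0 ?mulr0 //=.
by apply: contra nb => /andP[/eqP E1 /eqP E2]; lia.
Qed.

(** The nonzero rows fill the boxes $[0,3h) \times [0,h)$ and $[0,h) \times [0,3h)$. Cutting the
    second at $2h$ gives $3h^2 + 2h^2 - h^2 = 4h^2$ rows, less the origin. *)
Lemma mxrank_peisert_kernel (G : 'M[F]_#|F|) c0 c1 c2 : c1 != 0 -> c2 != 0 ->
    (forall i j, G i j = c0
       + c1 * (enum_val i - enum_val j) ^+ ((3 * h).-1 + p * h.-1)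
       + c2 * (enum_val i - enum_val j) ^+ (h.-1 + p * (3 * h).-1)) ->
  \rank (kermx (const_mx 1 : 'cV[F]_#|F|) *m G) = (4 * h ^ 2).-1%N.
Proof.
move=> nzc1 nzc2 GE.
have ap : ((3 * h).-1 < p)%N by lia.
have bp : (h.-1 < p)%N by lia.
rewrite (mxrank_box_kernel ap bp bp ap GE).
pose B I J : F := if monomial_degree I == 0%N then 0 else
  c1 * box_coeff (3 * h).-1 h.-1 I J + c2 * box_coeff h.-1 (3 * h).-1 I J.
pose box m n := [set I : 'I_p * 'I_p | ((I.1 < m) && (I.2 < n))%N].
pose R0 := (box (3 * h)%N h :|: box h (2 * h)%N) :\ (o 0, o 0).
(* The rows of the two boxes overlap in [0,h) x [0,h), where phi follows the first monomial; the
   remaining rows, in [0,h) x [2h,3h), are proportional to rows of the first box. *)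
pose phi (I : 'I_p * 'I_p) := if (I.2 < h)%N then (o ((3 * h).-1 - I.1), o (h.-1 - I.2))
  else (o (h.-1 - I.1), o ((3 * h).-1 - I.2)).
have deg0 I : (monomial_degree I == 0%N) = (I == (o 0, o 0)).
  by rewrite -(inj_eq monomial_degree_inj) /monomial_degree /= mod0n muln0.
rewrite -[LHS]/(\rank (\matrix_(I, J) B (enum_val I) (enum_val J))).
have eq0 a b (I J : 'I_p * 'I_p) : (a < p)%N -> (b < p)%N ->
    (I.1 + J.1 != a)%N || (I.2 + J.2 != b)%N ->
    box_coeff a b I J = 0.
  by move=> *; rewrite box_coeff_eq0 // negb_and.
rewrite (@mxrank_sparse _ _ B R0 phi).
- have := cardsD1 (o 0, o 0) (box (3 * h)%N h :|: box h (2 * h)%N).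
  rewrite -/R0 !inE /= mod0n muln_gt0 h_gt0 /= cardsU.
  have -> : box (3 * h)%N h :&: box h (2 * h)%N = box h h.
    by apply/setP=> I; rewrite !inE; lia.
  rewrite !card_box; lia.
- move=> [i j]; rewrite !inE /B deg0 /= => /andP[/negPf-> ij]; rewrite /phi /=.
  case: ifP => jh.
    rewrite [X in _ + _ * X]eq0 //=; last by rewrite !modn_small; lia.
    rewrite mulr0 addr0 mulf_neq0 // box_coeff_neq0 //= !modn_small; lia.
  rewrite [X in _ * X + _]eq0 //=; last by rewrite !modn_small; lia.
  rewrite mulr0 add0r mulf_neq0 // box_coeff_neq0 //= !modn_small; lia.
- move=> [i j] [i' j']; rewrite !inE /B deg0 /= => /andP[/negPf-> ij] /andP[_ ij'] ne.
  have {}ne : (i != i' :> nat) || (j != j' :> nat).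
    by rewrite -negb_and; apply: contra ne => /andP[/eqP/val_inj-> /eqP/val_inj->].
  rewrite /phi /=; case: ifP => j'h; rewrite !eq0 ?mulr0 ?addr0 //= ?modn_small; lia.
move=> [i j]; rewrite !inE /B deg0 /= negb_and negbK => /orP[->|nb]; first by left.
have [ij|nij] := boolP ((i < h) && (j < 3 * h))%N; last first.
  by left=> J; case: ifP => // _; rewrite !eq0 ?mulr0 ?addr0 //=; lia.
right; have s1 : (2 * h + i < p)%N by lia.
have s2 : (j - 2 * h < p)%N by lia.
(* The rows [(i, j)] and [s] each have a single nonzero entry, both in column [t]: the first from
   the second monomial, the other from the first. *)
pose s : 'I_p * 'I_p := (o (2 * h + i), o (j - 2 * h)).
pose t : 'I_p * 'I_p := (o (h.-1 - i), o ((3 * h).-1 - j)).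
have s_neq0 : s != (o 0, o 0).
  by apply/eqP=> /(congr1 (fun I => val I.1)) /=; rewrite !modn_small; lia.
have r_neq0 : (i, j) != (o 0, o 0).
  by apply/eqP=> /(congr1 (fun I => val I.2)) /=; rewrite mod0n; lia.
have nz_s : box_coeff (3 * h).-1 h.-1 s t != 0.
  rewrite box_coeff_neq0 //= !modn_small; lia.
exists s, (c2 * box_coeff h.-1 (3 * h).-1 (i, j) t / (c1 * box_coeff (3 * h).-1 h.-1 s t)).
split; first by rewrite in_setD1 s_neq0 !inE /= !modn_small; lia.
move=> J; rewrite ?deg0 (negPf r_neq0) (negPf s_neq0).
rewrite [X in c1 * X + _]eq0 //=; last by lia.
rewrite [X in _ * (_ + c2 * X)]eq0 //=; last by rewrite !modn_small; lia.
rewrite !mulr0 add0r addr0; have [->|nt] := eqVneq J t.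
  by rewrite divfK // mulf_neq0.
have {}nt : (J.1 != h.-1 - i :> nat)%N || (J.2 != (3 * h).-1 - j :> nat)%N.
  rewrite -negb_and; apply: contra nt => /andP[/eqP E1 /eqP E2].
  rewrite [J]surjective_pairing; apply/eqP; congr (_, _); apply: val_inj;
    by rewrite /= modn_small //; lia.
rewrite (eq0 _ _ (i, j) J) ?(eq0 _ _ s J) ?mulr0 //= ?modn_small; lia.
Qed.

End TranslationKernels.

(** * The two graphs *)

Section SetMatrices.

Variables (F : finFieldType) (p e : nat) (D : {set F}).
Hypotheses (charFp : p \in [pchar F]) (cardF : #|F| = (p ^ 2)%N).
Hypotheses (e_gt0 : (0 < e)%N) (D0 : 0 \notin D) (cardD : #|D| = (p.-1 * e)%N).
Hypothesis DK : {in D, forall x y, y ^+ p = y -> y != 0 -> x * y \in D}.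

Definition difference_mx : 'M[int]_#|F| :=
  \matrix_(i, j) (shifted_indicator e D (enum_val i - enum_val j))%:R.

Lemma difference_mx_row_sum : difference_mx *m const_mx 1 = const_mx (p%:Z * e%:Z) :> 'cV_#|F|.
Proof.
apply/colP=> i; rewrite !mxE -PoszM -(line_union_sum charFp cardD) -natz natr_sum.
rewrite [RHS](reindex_inj (inj_comp (addrI (enum_val i)) oppr_inj)) -[RHS]sum_enum_val /=.
by apply: eq_bigr => j _; rewrite !mxE mulr1.
Qed.

Lemma difference_mx_col_sum : const_mx 1 *m difference_mx = const_mx (p%:Z * e%:Z) :> 'rV_#|F|.
Proof.
apply/rowP=> j; rewrite !mxE -PoszM -(line_union_sum charFp cardD) -natz natr_sum.
rewrite [RHS](reindex_inj (addIr (- enum_val j))) -[RHS]sum_enum_val /=.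
by apply: eq_bigr => i _; rewrite !mxE mul1r.
Qed.

Lemma difference_mx_sqr :
  difference_mx *m difference_mx = p%:Z *: difference_mx + const_mx (e%:Z * (e%:Z - 1)).
Proof.
apply/matrixP=> i j; set z := enum_val i - enum_val j.
have := line_union_convolution charFp cardF D0 cardD DK z.
move/(congr1 (fun m => m%:R : int)); rewrite natr_sum natrD !natrM => E.
rewrite !mxE -/z -[p%:Z]natz -[e%:Z]natz -[_ - 1]/(_ - 1%:R) -natrB ?subn1 -?E //.
rewrite [RHS](reindex_inj (inj_comp (addrI (enum_val i)) oppr_inj)) -[RHS]sum_enum_val /=.
apply: eq_bigr => k _; rewrite !mxE natrM; congr (_ * (shifted_indicator e D _)%:R).
by rewrite /z; ring.
Qed.

Lemma difference_mx_trace : \tr difference_mx = p%:Z ^+ 2 * e%:Z.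
Proof.
rewrite /mxtrace (eq_bigr (fun=> e%:R)) => [|i _]; last first.
  by rewrite mxE subrr /shifted_indicator (negPf D0) eqxx muln1.
by rewrite sumr_const card_ord cardF -[LHS]mulr_natl natrX !natz.
Qed.

End SetMatrices.

Definition regular_mx_data (F : fieldType) (p : nat) (e : int) (c n : nat) (N : 'M[int]_n) : Prop :=
  [/\ N *m const_mx 1 = const_mx (p%:Z * e) :> 'cV_n,
      const_mx 1 *m N = const_mx (p%:Z * e) :> 'rV_n,
      N *m N = p%:Z *: N + const_mx (e * (e - 1)),
      \tr N = p%:Z ^+ 2 * e
    & \rank (kermx (const_mx 1 : 'cV[F]_n) *m map_mx intr N) = c].

Lemma regular_mx_similar (F : fieldType) (p : nat) (e : int) c g n (N N' : 'M[int]_n) :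
    p \in [pchar F] -> (0 < g)%N -> p%:Z + 1 = e * 2 ->
    (n = 1 + ((c.+2 + g) + (c.+2 + g)))%N -> (n = p ^ 2)%N ->
    regular_mx_data F p e c.+2 N -> regular_mx_data F p e c.+2 N' ->
  exists2 T, T \in unitmx & T *m N = N' *m T.
Proof.
move=> charFp g0 pe En nE; subst n.
move=> [N1 N2 N3 N4 N5] [N1' N2' N3' N4' N5'].
have [T uT TN] := regular_normal_form charFp g0 pe nE N1 N2 N3 N4 N5.
have [T' uT' TN'] := regular_normal_form charFp g0 pe nE N1' N2' N3' N4' N5'.
exists (invmx T' *m T); first by rewrite unitmx_mul unitmx_inv uT'.
rewrite -mulmxA TN !mulmxA; congr (_ *m _).
by rewrite -[LHS](mulmxK uT') -(mulmxA (invmx T')) -TN' !mulmxA mulVmx // mul1mx.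
Qed.

Lemma similar_scalar_shift n (A A' T : 'M[int]_n) a :
  T \in unitmx -> T *m (A + a%:M) = (A' + a%:M) *m T -> T *m A *m invmx T = A'.
Proof.
move=> uT; rewrite mulmxDr mulmxDl scalar_mxC => /addIr ->.
by rewrite mulmxK.
Qed.

(** * Fourth-power cosets and their indicator polynomials *)

Section PrimitiveElement.

Variables (p h : nat) (F : finFieldType) (beta : {unit F}).
Hypotheses (p_pr : prime p) (ph : p.+1 = (4 * h)%N) (cardF : #|F| = (p ^ 2)%N).
Hypothesis beta_prim : primitive_element beta.

(** Here $n = (q-1)/4$, so $w$ is a primitive fourth root of unity and $z \mapsto z^n$ tells the
    four cosets apart. *)
Let n := (h * p.-1)%N.
Let w : F := val beta ^+ n.

Let charFp : p \in [pchar F]. Proof. exact: card_finPcharP cardF p_pr. Qed.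

Let p_gt1 : (1 < p)%N. Proof. exact: prime_gt1. Qed.

Let h_gt0 : (0 < h)%N. Proof. by lia. Qed.

Let n_gt0 : (0 < n)%N. Proof. by rewrite muln_gt0 h_gt0 /=; lia. Qed.

Let card_units : (#|F|.-1 = 4 * n)%N.
Proof. by rewrite cardF /n; nia. Qed.

Let order_beta : #[beta]%g = (4 * n)%N.
Proof.
by rewrite -card_units -card_finField_unit; move/eqP: beta_prim => ->.
Qed.

Let beta_gen (u : {unit F}) : u \in <[beta]>%g.
Proof. by move/eqP: beta_prim => <-; rewrite inE. Qed.

Let mem_coset (u : {unit F}) k :
  (u \in (beta ^+ k *: fourth_powers beta)%g) = (val u ^+ n == w ^+ k).
Proof.
rewrite mem_lcoset; set v := (beta ^- k * u)%g.
have -> : u = (beta ^+ k * v)%g by rewrite /v mulKVg.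
have -> : (val (beta ^+ k * v)%g ^+ n == w ^+ k) = (v ^+ n == 1)%g.
  rewrite -[RHS](inj_eq val_inj) FinRing.val_unitM !FinRing.val_unitX FinRing.val_unit1.
  rewrite exprMn exprAC -/w -[X in _ == X]mulr1; apply/eqP/eqP => [|->] //.
  by apply: mulfI; rewrite !expf_neq0 // -unitfE (valP beta).
apply/idP/eqP=> [/cycleP[j ->]|].
  by apply/eqP; rewrite -!expgM -order_dvdn order_beta dvdn_mul // dvdn_mull.
have /cycleP[j ->] := beta_gen v.
move/eqP; rewrite -expgM -order_dvdn order_beta dvdn_pmul2r // => /dvdnP[m ->].
by rewrite mulnC expgM mem_cycle.
Qed.

Let mem_val_coset z k :
  (z \in [set val u | u in (beta ^+ k *: fourth_powers beta)%g]) = (z ^+ n == w ^+ k).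
Proof.
have w0 : w ^+ k != 0 by rewrite !expf_neq0 // -unitfE (valP beta).
apply/imsetP/idP=> [[u uU ->]|zn]; first by rewrite -mem_coset.
have z0 : z != 0.
  by apply: contraNneq w0 => z0; rewrite -(eqP zn) z0 expr0n -[n == 0%N]negbK -lt0n n_gt0.
have uz : z \is a GRing.unit by rewrite unitfE.
by exists (FinRing.unit F uz); rewrite ?mem_coset.
Qed.

Let w4 : w ^+ 4 = 1.
Proof.
by rewrite /w -exprM mulnC -order_beta -FinRing.val_unitX expg_order FinRing.val_unit1.
Qed.

Let w2 : w ^+ 2 = -1.
Proof.
have : (w ^+ 2 - 1) * (w ^+ 2 + 1) = 0 by rewrite -[RHS](subrr (w ^+ 4)) {2}w4; ring.
move/eqP; rewrite mulf_eq0 subr_eq0 addr_eq0 => /orP[w21|/eqP //].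
have : (beta ^+ (n * 2) == 1)%g.
  by rewrite -(inj_eq val_inj) FinRing.val_unitX FinRing.val_unit1 exprM.
by rewrite -order_dvdn order_beta [(4 * n)%N]mulnC dvdn_pmul2l.
Qed.

Let nz2 : 2 != 0 :> F.
Proof. by rewrite -(dvdn_pcharf charFp) gtnNdvd //; lia. Qed.

Let pow_n (z : F) : z != 0 -> [|| z ^+ n == 1, z ^+ n == w, z ^+ n == -1 | z ^+ n == - w].
Proof.
move=> z0; have uz : z \is a GRing.unit by rewrite unitfE.
have /cycleP[j] := beta_gen (FinRing.unit F uz).
move/(congr1 val); rewrite FinRing.val_unitX /= => ->.
rewrite -exprM mulnC exprM -/w (divn_eq j 4) exprD mulnC exprM w4 expr1n mul1r.
have : (j %% 4 < 4)%N by rewrite ltn_mod.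
case: (j %% 4)%N => [|[|[|[|//]]]] _;
  by rewrite ?expr0 ?expr1 ?(exprSr w 2) ?w2 ?mulN1r ?eqxx ?orbT.
Qed.

Let w_distinct : ((w == 1 = false) * (1 == w = false) * (w == -1 = false) * (-1 == w = false)
  * (1 == -1 :> F = false) * (-1 == 1 :> F = false) * (w == - w = false) * (- w == w = false)
  * (- w == 1 = false) * (1 == - w = false) * (- w == -1 = false) * (-1 == - w = false))%type.
Proof.
have n1 : (1 == -1 :> F) = false by rewrite -subr_eq0 opprK; apply: negPf.
have nw1 : (w == 1) = false.
  by apply/eqP=> w1; move: w2 n1; rewrite w1 expr1n => {1}->; rewrite eqxx.
have nwN1 : (w == -1) = false.
  by apply/eqP=> w1; move: w2 n1; rewrite w1 sqrrN expr1n => {1}->; rewrite eqxx.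
have w_neq0 : w != 0 by rewrite expf_neq0 // -unitfE (valP beta).
have nw : (w == - w) = false.
  by rewrite -subr_eq0 opprK -mulr2n -mulr_natl mulf_eq0 (negPf nz2) (negPf w_neq0).
by do !split; first [by [] | by rewrite eq_sym | by rewrite eqr_opp | by rewrite eqr_oppLR
  | by rewrite eq_sym eqr_opp | by rewrite eq_sym eqr_oppLR].
Qed.

Section PowerResidueSet.

Variable k : nat.
Hypothesis k12 : (0 < k < 3)%N.

(** The case $k = 2$ is the Paley connection set, $k = 1$ the Peisert one. *)
Let D : {set F} := [set z | (z ^+ n == 1) || (z ^+ n == w ^+ k)].

Let D0 : 0 \notin D.
Proof.
rewrite inE expr0n -[n == 0%N]negbK -lt0n n_gt0 /= eq_sym oner_eq0 /= eq_sym.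
by rewrite !expf_neq0 // -unitfE (valP beta).
Qed.

Let DK : {in D, forall x y, y ^+ p = y -> y != 0 -> x * y \in D}.
Proof.
move=> x; rewrite inE => xD y yp y0; suff yn : y ^+ n = 1 by rewrite inE exprMn yn mulr1.
have yp1 : y ^+ p.-1 = 1 by apply: (mulIf y0); rewrite -exprSr prednK ?mul1r // ltnW.
by rewrite /n mulnC exprM yp1 expr1n.
Qed.

(** Multiplication by $\beta^{3-k}$ exchanges $D$ with its complement in the nonzero elements, so
    $D$ is half of them. *)
Let cardD : #|D| = (p.-1 * (2 * h))%N.
Proof.
pose g : F := val beta ^+ (3 - k).
have g0 : g != 0 by rewrite expf_neq0 // -unitfE (valP beta).
have gn : g ^+ n = w ^+ (3 - k) by rewrite /g exprAC.
have gD : [set g * z | z in D] = [set~ 0] :\: D.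
  apply/setP=> z; rewrite in_setD in_setC1; apply/imsetP/andP => [[x]|[zD z0]].
    move=> xD ->; have x0 : x != 0 by apply: contraTneq xD => ->.
    rewrite mulf_neq0 //; move: xD; rewrite !inE exprMn gn.
    case: k k12 => [|[|[|]]] //= _; rewrite ?subn1 ?subSS ?subn0 ?expr1 ?w2 => /orP[] /eqP->;
      rewrite ?mulr1 ?mulrN1 ?mulN1r -?expr2 ?w2 ?w_distinct //.
  exists (z / g); last by rewrite mulrC divfK.
  rewrite !inE exprMn exprVn gn; have := pow_n z0; move: zD; rewrite inE.
  have wV : w^-1 = - w.
    have w0 : w != 0 by rewrite expf_neq0 // -unitfE (valP beta).
    by apply: (mulfI w0); rewrite divff // mulrN -expr2 w2 opprK.
  case: k k12 => [|[|[|]]] //= _; rewrite ?subn1 ?subSS ?subn0 ?expr1 ?w2 ?invrN1 ?wV;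
    move=> nzn /or4P[] /eqP zn; move: nzn; rewrite zn ?w_distinct ?eqxx ?mulrN ?mulNr ?mulr1;
    by rewrite ?mul1r -?expr2 ?w2 ?opprK ?eqxx ?orbT.
have cU : #|[set~ 0 : F]| = #|F|.-1 by rewrite cardsC1.
have subD : D \subset [set~ 0].
  by apply/subsetP=> z zD; rewrite in_setC1; apply: contraTneq zD => ->.
have : #|D| = #|[set~ 0] :\: D|.
  by rewrite -gD card_imset //; apply: mulfI.
rewrite cardsD (setIidPr subD).
rewrite cU card_units /n; have : (#|D| <= #|F|.-1)%N by rewrite -cU subset_leq_card.
have -> : (p.-1 * (2 * h) = 2 * (h * p.-1))%N by ring.
rewrite card_units /n; move: #|D| (h * p.-1)%N => x y; lia.
Qed.

Lemma power_residue_mx_data c :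
    \rank (kermx (const_mx 1 : 'cV[F]_#|F|) *m map_mx intr (difference_mx (2 * h) D)) = c ->
  regular_mx_data F p (2 * h)%N%:Z c (difference_mx (2 * h) D).
Proof.
move=> rkD; split=> //.
- exact: difference_mx_row_sum.
- exact: difference_mx_col_sum.
- by apply: difference_mx_sqr => //; lia.
- exact: difference_mx_trace.
Qed.

End PowerResidueSet.

Local Notation D k := [set z : F | (z ^+ n == 1) || (z ^+ n == w ^+ k)].

(** This makes the diagonal shift agree at $z = 0$ with the constant term of the indicator
    polynomials. *)
Let half_p : (2 * h)%:R = 2^-1 :> F.
Proof.
apply: (mulIf nz2); rewrite mulVf // -natrM (_ : (2 * h * 2)%N = (p + 1)%N) ?natrD;
  last by lia.
by rewrite (pcharf0 charFp) add0r.
Qed.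

Let n2E : (n * 2 = (2 * h).-1 + p * (2 * h).-1)%N.
Proof.
have pE : (p.-1 = 2 * (2 * h).-1)%N by lia.
by rewrite -mulSn ph /n pE; ring.
Qed.

Let n_decomp : exists b, [/\ n = (b.+1 * (4 * b + 2))%N, p = (4 * b + 3)%N, h.-1 = b
  & (3 * h).-1 = (3 * b + 2)%N].
Proof. by exists h.-1; rewrite /n prednK //; split; try lia; congr (_ * _)%N; lia. Qed.

Let nE : (n = (3 * h).-1 + p * h.-1)%N.
Proof. by case: n_decomp => b [-> -> -> ->]; ring. Qed.

Let n3E : (n * 3 = h.-1 + p * (3 * h).-1)%N.
Proof. by case: n_decomp => b [-> -> -> ->]; ring. Qed.

Let map_difference_mx k i j : map_mx intr (difference_mx (2 * h) (D k)) i j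
  = (shifted_indicator (2 * h) (D k) (enum_val i - enum_val j))%:R :> F.
Proof. by rewrite !mxE rmorph_nat. Qed.

Let indicator0 k : (shifted_indicator (2 * h) (D k) 0)%:R = 2^-1 :> F.
Proof.
rewrite /shifted_indicator eqxx muln1 inE expr0n -[n == 0%N]negbK -lt0n n_gt0 /=.
rewrite eq_sym oner_eq0 eq_sym expf_eq0 expf_eq0 -[val beta == 0]negbK.
by rewrite -unitfE (valP beta) !andbF half_p.
Qed.

Let halfD : 2^-1 + 2^-1 = 1 :> F.
Proof. by apply: (mulIf nz2); rewrite mulrDl !mulVf // mul1r. Qed.

Let paley_indicator z :
  (shifted_indicator (2 * h) (D 2) z)%:R = 2^-1 + 2^-1 * z ^+ (n * 2) :> F.
Proof.
have [->|z0] := eqVneq z 0.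
  by rewrite indicator0 expr0n muln_eq0 orbF -[n == 0%N]negbK -lt0n n_gt0 mulr0 addr0.
rewrite /shifted_indicator inE (negPf z0) muln0 addn0 exprM.
have := pow_n z0 => /or4P[] /eqP->; rewrite w2 ?sqrrN ?w2 ?w_distinct ?eqxx ?expr1n;
  by rewrite ?mulr1 ?mulrN1 ?subrr ?halfD.
Qed.

(** [c1] and [c3] are Fourier coefficients of the indicator of $\{1, w\}$ on the fourth roots of
    unity; the coefficient of the square, $(1 + w^2)/4$, vanishes. *)
Let c1 : F := (1 - w) * (2^-1 * 2^-1).
Let c3 : F := (1 + w) * (2^-1 * 2^-1).

Let peisert_indicator z :
  (shifted_indicator (2 * h) (D 1) z)%:R = 2^-1 + c1 * z ^+ n + c3 * z ^+ (n * 3) :> F.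
Proof.
have [->|z0] := eqVneq z 0.
  by rewrite indicator0 !expr0n muln_eq0 orbF -[n == 0%N]negbK -lt0n n_gt0 !mulr0 !addr0.
have quarter : 2^-1 * 2^-1 * 2 = 2^-1 :> F by rewrite mulfVK.
have E1 : c1 + c3 = 2^-1 by rewrite -[RHS]quarter /c1 /c3; ring.
have w3 : w ^+ 3 = - w by rewrite exprSr w2 mulN1r.
have Ew : c1 * w + c3 * w ^+ 3 = 2^-1.
  transitivity (2^-1 * 2^-1 * 2 * - w ^+ 2 : F); last by rewrite w2 opprK mulr1.
  by rewrite w3 /c1 /c3; ring.
rewrite /shifted_indicator inE (negPf z0) muln0 addn0 exprM -addrA.
have := pow_n z0 => /or4P[] /eqP->; rewrite expr1 ?w_distinct ?eqxx ?orbT /=.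
- by rewrite expr1n !mulr1 E1 halfD.
- by rewrite Ew halfD.
- by rewrite -signr_odd /= expr1 !mulrN1 -opprD E1 subrr.
- by rewrite exprNn -signr_odd /= expr1 mulN1r !mulrN -opprD Ew subrr.
Qed.

Let c1_neq0 : c1 != 0.
Proof. by rewrite !mulf_neq0 ?invr_eq0 // subr_eq0 w_distinct. Qed.

Let c3_neq0 : c3 != 0.
Proof. by rewrite !mulf_neq0 ?invr_eq0 // addrC addr_eq0 w_distinct. Qed.

Lemma paley_mx_data :
  regular_mx_data F p (2 * h)%N%:Z (4 * h ^ 2).-1 (difference_mx (2 * h) (D 2)).
Proof.
apply: power_residue_mx_data => //.
have nzh : 2^-1 != 0 :> F by rewrite invr_eq0.
apply: (mxrank_paley_kernel charFp cardF h_gt0 ph nzh) => i j.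
by rewrite map_difference_mx paley_indicator n2E.
Qed.

Lemma peisert_mx_data :
  regular_mx_data F p (2 * h)%N%:Z (4 * h ^ 2).-1 (difference_mx (2 * h) (D 1)).
Proof.
apply: power_residue_mx_data => //.
apply: (mxrank_peisert_kernel charFp cardF h_gt0 ph c1_neq0 c3_neq0) => i j.
by rewrite map_difference_mx peisert_indicator -n3E -nE.
Qed.

Let adjacencyE k (r : rel F) :
    (forall x y, r x y = (x - y \in D k)) ->
  adjacency_mx r + (2 * h)%N%:Z%:M = difference_mx (2 * h) (D k).
Proof.
move=> rE; apply/matrixP=> i j; rewrite !mxE rE /shifted_indicator natrD natrM.
by rewrite subr_eq0 (inj_eq enum_val_inj) -[_ *+ (i == j)]mulr_natr !natz.
Qed.

Lemma adjacency_paley_mx :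
  adjacency_mx (paley_rel beta) + (2 * h)%N%:Z%:M = difference_mx (2 * h) (D 2).
Proof.
apply: adjacencyE => x y; rewrite /paley_rel imsetU in_setU mem_val_coset inE.
by have := mem_val_coset (x - y) 0; rewrite expg0 lcoset1 expr0 => ->.
Qed.

Lemma adjacency_peisert_mx :
  adjacency_mx (peisert_rel beta) + (2 * h)%N%:Z%:M = difference_mx (2 * h) (D 1).
Proof.
apply: adjacencyE => x y; rewrite /peisert_rel imsetU in_setU inE.
have := mem_val_coset (x - y) 0; rewrite expg0 lcoset1 expr0 => ->.
by have := mem_val_coset (x - y) 1; rewrite expg1 => ->.
Qed.

Lemma paley_peisert_similar :
  exists2 T : 'M[int]_#|F|, T \in unitmx &
    T *m adjacency_mx (paley_rel beta) *m invmx T = adjacency_mx (peisert_rel beta).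
Proof.
(* [g] is the corank $(p^2 - 1)/2 - (4h^2 - 1) = (2h - 1)^2$ of the block $C$, and [c.+2] is its
   rank. *)
pose g := ((2 * h).-1 ^ 2)%N; pose c := (4 * h ^ 2 - 3)%N.
have cE : (4 * h ^ 2).-1 = c.+2 by rewrite /c; have : (0 < h ^ 2)%N; [rewrite expn_gt0 h_gt0 | lia].
have := paley_mx_data; have := peisert_mx_data; rewrite cE => dat' dat.
have g_gt0 : (0 < g)%N by rewrite expn_gt0; lia.
have pe : p%:Z + 1 = (2 * h)%N%:Z * 2 by lia.
have nE' : (#|F| = 1 + ((c.+2 + g) + (c.+2 + g)))%N.
  rewrite cardF -cE /g; case: n_decomp => b [_ -> hb _].
  have -> : h = b.+1 by lia.
  have -> : (2 * b.+1).-1 = (2 * b + 1)%N by lia.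
  have -> : (4 * b.+1 ^ 2).-1 = (4 * b ^ 2 + 8 * b + 3)%N.
    by rewrite -[RHS]/(_.+1.-1); congr _.-1; rewrite -[RHS]addn1; ring.
  by ring.
have [T uT TN] := regular_mx_similar charFp g_gt0 pe nE' cardF dat dat'.
exists T => //; apply: (@similar_scalar_shift _ _ _ _ (2 * h)%N%:Z) => //.
by rewrite adjacency_paley_mx adjacency_peisert_mx.
Qed.

End PrimitiveElement.

Theorem theorem4p1 (p : nat) (p_prime : prime p) (p_mod4 : p = 3 %[mod 4])
    (F : finFieldType) (cardF : #|F| = (p ^ 2)%N)
    (beta : {unit F}) (beta_prim : primitive_element beta) :
  exists2 T : 'M[int]_#|F|, T \in unitmx &
    T *m adjacency_mx (paley_rel beta) *m invmx T
      = adjacency_mx (peisert_rel beta).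
Proof.
apply: (@paley_peisert_similar p (p.+1 %/ 4)) => //.
by rewrite mulnC divnK //; lia.
Qed.
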